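(* Let $W:[0,1]\to\mathbb C$ be $(\sigma_*,2)$-Gevrey regular, $0<\sigma<\sigma_*$, $\delta>0$ and $s\in\mathbb C$. Suppose $u\in H^2(I)$ has support in $[\delta,1]$, vanishes at $x=1$ in the trace sense, and satisfies $\mathcal L_su=f$ for some $f\in Y^\sigma$. Then $u\in X^\sigma$ and $\|u\|_{X^\sigma}\le C(\|f\|_{Y^\sigma}+\|u\|_{L^2(I)})$ for a constant $C$ depending on $\sigma,\delta,s,W$ but not on $u$ or $f$.
   Context: Let $I=(0,1)$. A function $u\in C^\infty(\overline I)$ is $(\sigma,k)$-Gevrey regular ($\sigma,k>0$) if there is $C>0$ with $\sup_{x\in I}|u^{(n)}(x)|\le C\sigma^{-n}(n!)^k$ for all $n\ge0$. For $\sigma>0$, $u\in C^\infty(\overline I)$, $k\in\{0,1,2\}$: $|u|^{0}_{\sigma,k,0}=\big(\sum_{n=0}^\infty\frac{\sigma^{2n}}{n!^2(n+1)!^2}n^{k}\int_0^1(x/\sigma)^k|\partial_x^nu|^2dx\big)^{1/2}$ (with $0^0:=1$), $\|u\|_{\sigma,0,0}=|u|^0_{\sigma,0,0}$, $[u]^0_\sigma=(\sum_{n=0}^\infty\frac{\sigma^{2n+1}}{n!^2(n+1)!^2}|u^{(n)}(0)|^2)^{1/2}$. $X^\sigma=\{u\in C^\infty(\overline I):u(1)=0,\ \|\partial_xu\|_{\sigma,0,0}+|\partial_xu|^0_{\sigma,1,0}+|\partial_xu|^0_{\sigma,2,0}+[\partial_xu]^0_\sigma<\infty\}$, $Y^\sigma=\{u\in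 C^\infty(\overline I):\|u\|_{\sigma,0,0}+|u|^0_{\sigma,1,0}+[u]^0_\sigma<\infty\}$, with norms $\|u\|_{X^\sigma}=(\|\partial_xu\|_{\sigma,0,0}^2+(|\partial_xu|^0_{\sigma,1,0})^2+(|\partial_xu|^0_{\sigma,2,0})^2+([\partial_xu]^0_\sigma)^2)^{1/2}$, $\|u\|_{Y^\sigma}=(\|u\|_{\sigma,0,0}^2+(|u|^0_{\sigma,1,0})^2+([u]^0_\sigma)^2)^{1/2}$. $\mathcal L_su=\frac{d}{dx}(x^2\frac{du}{dx})+s\frac{du}{dx}-Wu$. *)

(* Defs.v *)
From Stdlib Require Import Reals Lra List ClassicalEpsilon Arith.Factorial.
Open Scope R_scope.

Record Cx := mkCx { Re : R; Im : R }.
Definition C0 : Cx := mkCx 0 0.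
Definition Cadd (z w : Cx) : Cx := mkCx (Re z + Re w) (Im z + Im w).
Definition Csub (z w : Cx) : Cx := mkCx (Re z - Re w) (Im z - Im w).
Definition Cmul (z w : Cx) : Cx :=
  mkCx (Re z * Re w - Im z * Im w) (Re z * Im w + Im z * Re w).
Definition Cscal (a : R) (z : Cx) : Cx := mkCx (a * Re z) (a * Im z).
Definition Cnorm2 (z : Cx) : R := Re z ^ 2 + Im z ^ 2.
Definition Cabs (z : Cx) : R := sqrt (Cnorm2 z).

Definition has_deriv01 (g : R -> Cx) (l : Cx) (x : R) : Prop :=
  forall eps, 0 < eps -> exists del, 0 < del /\
    forall y, 0 <= y <= 1 -> y <> x -> Rabs (y - x) < del ->
      Cabs (Csub (Cscal (/ (y - x)) (Csub (g y) (g x))) l) < eps.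

(** [D n] is the n-th derivative of g on [0,1]; existence of such a chain
    means g is in C^infinity([0,1]). *)
Definition deriv_chain (g : R -> Cx) (D : nat -> R -> Cx) : Prop :=
  (forall x, 0 <= x <= 1 -> D O x = g x) /\
  (forall n x, 0 <= x <= 1 -> has_deriv01 (D n) (D (S n) x) x).

Definition Gevrey (sig k : R) (W : R -> Cx) : Prop :=
  exists D, deriv_chain W D /\
    exists K, 0 < K /\ forall n x, 0 < x < 1 ->
      Cabs (D n x) <= K * / sig ^ n * Rpower (INR (fact n)) k.

(** * Riemann integral as a total function (0 if not integrable). *)
Definition is_RInt (g : R -> R) (a b v : R) : Prop :=
  exists pr : Riemann_integrable g a b, RiemannInt pr = v.
Definition Rint (g : R -> R) (a b : R) : R :=
  match excluded_middle_informative (exists v, is_RInt g a b v) with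
  | left H => proj1_sig (constructive_indefinite_description _ H)
  | right _ => 0
  end.
Definition Cint (g : R -> Cx) (a b : R) : Cx :=
  mkCx (Rint (fun x => Re (g x)) a b) (Rint (fun x => Im (g x)) a b).

Definition sums_to (a : nat -> R) (l : R) : Prop :=
  Un_cv (fun N => sum_f_R0 a N) l.

(** * The Gevrey-type norms. [D] is the derivative chain of the function. *)
Definition wt (sig : R) (n : nat) : R :=
  sig ^ (2 * n) / (INR (fact n) ^ 2 * INR (fact (S n)) ^ 2).
Definition normterm (sig : R) (k : nat) (D : nat -> R -> Cx) (n : nat) : R :=
  wt sig n * INR n ^ k * Rint (fun x => (x / sig) ^ k * Cnorm2 (D n x)) 0 1.
Definition bdterm (sig : R) (D : nat -> R -> Cx) (n : nat) : R :=
  sig * wt sig n * Cnorm2 (D n 0).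

(** [inY sig f v]: f in Y^sigma and ||f||_{Y^sigma}^2 = v. *)
Definition inY (sig : R) (f : R -> Cx) (v : R) : Prop :=
  exists F, deriv_chain f F /\
    exists l0 l1 lb, sums_to (normterm sig 0 F) l0 /\ sums_to (normterm sig 1 F) l1 /\
      sums_to (bdterm sig F) lb /\ v = l0 + l1 + lb.

(** [inX sig u v]: u in X^sigma and ||u||_{X^sigma}^2 = v
    (norms applied to the derivative chain of d/dx u). *)
Definition inX (sig : R) (u : R -> Cx) (v : R) : Prop :=
  exists D, deriv_chain u D /\ u 1 = C0 /\
    let D' := fun n => D (S n) in
    exists l0 l1 l2 lb, sums_to (normterm sig 0 D') l0 /\ sums_to (normterm sig 1 D') l1 /\
      sums_to (normterm sig 2 D') l2 /\ sums_to (bdterm sig D') lb /\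
      v = l0 + l1 + l2 + lb.

Definition L2norm01 (u : R -> Cx) : R := sqrt (Rint (fun x => Cnorm2 (u x)) 0 1).

(** * Sobolev spaces in 1D without Lebesgue integration.
    H^1(0,1) via F. Riesz's characterization: v (continuous representative)
    has bounded sums  sum |v(t_{i+1}) - v(t_i)|^2 / (t_{i+1} - t_i)
    over all partitions of [0,1]. *)
Fixpoint riesz_sum (v : R -> Cx) (l : list R) : R :=
  match l with
  | a :: ((b :: _) as t) => Cnorm2 (Csub (v b) (v a)) / (b - a) + riesz_sum v t
  | _ => 0
  end.
Fixpoint increasing (l : list R) : Prop :=
  match l with
  | a :: ((b :: _) as t) => a < b /\ increasing t
  | _ => True
  end.
Definition partition01 (l : list R) : Prop :=
  increasing l /\ Forall (fun t => 0 <= t <= 1) l.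
Definition H1 (v : R -> Cx) : Prop :=
  exists M, forall l, partition01 l -> riesz_sum v l <= M.
(** [H2 u up]: (the continuous representative) u is C^1 on [0,1] with
    derivative up, and up is in H^1. *)
Definition H2 (u up : R -> Cx) : Prop :=
  (forall x, 0 <= x <= 1 -> has_deriv01 u (up x) x) /\ H1 up.

(** * L_s u = f in the weak (distributional) sense on I=(0,1):
    test functions are real C_c^infinity((0,1)) functions, P n = n-th derivative. *)
Definition test_fun (P : nat -> R -> R) : Prop :=
  (forall n x, derivable_pt_lim (P n) x (P (S n) x)) /\
  exists a b, 0 < a /\ a < b /\ b < 1 /\ forall x, (x < a \/ b < x) -> P O x = 0.

Definition weak_Ls (s : Cx) (W u up f : R -> Cx) : Prop :=
  forall P, test_fun P ->
    Cint (fun x => Cadd (Cscal (- (x ^ 2 * P 1%nat x)) (up x))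
                        (Cscal (P O x) (Csub (Csub (Cmul s (up x)) (Cmul (W x) (u x))) (f x))))
         0 1 = C0.

(* Main.v *)
(** Testing the weak equation against smooth plateau functions shows that x^2 u' has
    the continuous derivative f + W u - s u'; since u vanishes on [0,delta), one may divide
    by x^2, and a bootstrap makes u smooth on [0,1], with all derivatives vanishing at 0.
    Pairing the equation with the conjugate of u bounds u' in L^2 by f and u.
    Differentiating n times expresses x^2 u^(n+2) through f^(n), u^(n+1), u^(n) and the
    Leibniz sum for W u. If ||u^(j)|| <= B sigma^-j (j!/(j+1))^2 for j <= n+1, the Gevrey-2
    bound on W gives the same bound for j = n+2 with B replaced by kappa B/(n+1). The factor
    kappa/(n+1) is at most 1 for large n, so B stays bounded, and its decay makes the
    weighted sums in the X-norm converge. *)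
From Stdlib Require Import Reals Lra Lia Factorial List.
From Coquelicot Require Import Coquelicot.
Require Import Defs.
Open Scope R_scope.
Set Bullet Behavior "Strict Subproofs".

(** * Calculus on the closed unit interval *)

(** Two scales drive the estimate. [nu n = sigma^-n n! (n+1)!] is the reciprocal square root of the
    weight in the norms, so a finite Y-norm bounds [f^(n)] in L^2 by [||f||_Y nu n], term by term.
    [alpha j = sigma^-j (j!/(j+1))^2] is the scale for [u^(j)]. If the lower derivatives of [u] obey
    it, all terms of the n times differentiated equation have size [nu n], and up to constants
    [nu n] is [alpha (n+2)/(n+1)]: this is the origin of the gain. On the scale [alpha] alone, the
    terms of the [k = 2] part of the X-norm would have order 1; the squared gain makes them of order
    [n^-2]. The degeneracy of [x^2] is met through the support condition. The equation forces [f],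
    too, to vanish on [[0,delta)], so the product form [x^2 u^(n+2) = rhs n] holds on all of [0,1]
    and the glueing at [delta] needs no matching of derivatives. *)

Definition clamp (x : R) : R := Rmax 0 (Rmin 1 x).
Definition I01 (x : R) : Prop := 0 <= x <= 1.

Lemma clamp_I01 x : I01 (clamp x).
Proof.
  unfold I01, clamp, Rmax, Rmin.
  destruct (Rle_dec 1 x); destruct (Rle_dec 0 _); lra.
Qed.

Lemma clamp_id x : I01 x -> clamp x = x.
Proof.
  unfold I01, clamp, Rmax, Rmin.
  destruct (Rle_dec 1 x); destruct (Rle_dec 0 _); lra.
Qed.

Lemma clamp_lip x y : Rabs (clamp y - clamp x) <= Rabs (y - x).
Proof.
  unfold clamp, Rmax, Rmin.
  destruct (Rle_dec 1 x), (Rle_dec 1 y); repeat destruct (Rle_dec 0 _);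
    unfold Rabs; repeat destruct (Rcase_abs _); lra.
Qed.

(** Composing with [clamp] extends a function from [0,1] by its end values. Continuity of the
    extension on R is continuity on [0,1], one-sided at the ends, in a form to which calculus on R
    applies directly. *)
Definition cont1 (r : R -> R) : Prop :=
  forall x, continuous (fun y => r (clamp y)) x.

Lemma cont1_const c : cont1 (fun _ => c).
Proof. intro x. apply continuous_const. Qed.

Lemma cont1_plus f g : cont1 f -> cont1 g -> cont1 (fun x => f x + g x).
Proof. intros hf hg x. apply (continuous_plus (V := R_NormedModule)); auto. Qed.

Lemma cont1_minus f g : cont1 f -> cont1 g -> cont1 (fun x => f x - g x).
Proof. intros hf hg x. apply (continuous_minus (V := R_NormedModule)); auto. Qed.

Lemma cont1_opp f : cont1 f -> cont1 (fun x => - f x).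
Proof. intros hf x. apply (continuous_opp (V := R_NormedModule)); auto. Qed.

Lemma cont1_mult f g : cont1 f -> cont1 g -> cont1 (fun x => f x * g x).
Proof. intros hf hg x. apply (continuous_mult (K := R_AbsRing)); auto. Qed.

Lemma cont1_pow f n : cont1 f -> cont1 (fun x => f x ^ n).
Proof.
  intros hf. induction n as [|n IH]; [apply (cont1_const 1)|].
  apply (cont1_mult f (fun x => f x ^ n)); auto.
Qed.

Lemma cont1_of_eps r :
  (forall x, I01 x -> forall eps, 0 < eps -> exists del, 0 < del /\
     forall y, I01 y -> Rabs (y - x) < del -> Rabs (r y - r x) < eps) ->
  cont1 r.
Proof.
  intros h x. apply continuity_pt_filterlim. intros eps heps.
  destruct (h (clamp x) (clamp_I01 x) eps heps) as [del [hd H]].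
  exists del. split; [exact hd|]. intros y [_ hy].
  apply H; [apply clamp_I01|].
  eapply Rle_lt_trans; [apply clamp_lip|exact hy].
Qed.

Lemma cont1_eps r x : cont1 r -> I01 x -> forall eps, 0 < eps ->
  exists del, 0 < del /\ forall y, I01 y -> Rabs (y - x) < del -> Rabs (r y - r x) < eps.
Proof.
  intros h hx eps heps. specialize (h x). apply continuity_pt_filterlim in h.
  destruct (h eps heps) as [del [hd H]]. exists del. split; [exact hd|].
  intros y hy hyx.
  destruct (Req_dec x y) as [<-|hne].
  - rewrite Rminus_diag. now rewrite Rabs_R0.
  - specialize (H y). simpl in H. unfold Rdist in H.
    rewrite !clamp_id in H by assumption. apply H.
    split; [split; [exact I|exact hne]|exact hyx].
Qed.

Lemma cont1_id : cont1 (fun x => x).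
Proof.
  apply cont1_of_eps. intros x _ eps he. exists eps. split; [exact he|auto].
Qed.

Lemma cont1_ext f g : (forall x, I01 x -> f x = g x) -> cont1 f -> cont1 g.
Proof.
  intros h hf x. apply continuous_ext with (fun y => f (clamp y)); [|apply hf].
  intro y. apply h, clamp_I01.
Qed.

Lemma cont1_continuous r : (forall x, continuous r x) -> cont1 r.
Proof.
  intros h. apply cont1_of_eps. intros x _ eps he.
  specialize (h x). apply continuity_pt_filterlim in h.
  destruct (h eps he) as [del [hd H]]. exists del. split; [exact hd|].
  intros y _ hyx. destruct (Req_dec x y) as [<-|hne].
  - rewrite Rminus_diag. now rewrite Rabs_R0.
  - apply (H y). split; [split; [exact I|exact hne]|exact hyx].
Qed.

(** Difference quotients stay inside [0,1], hence are one-sided at 0 and 1, as in [has_deriv01]. *)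
Definition dI (r : R -> R) (l x : R) : Prop := D_in r (fun _ => l) I01 x.

Lemma dI_eps r l x : dI r l x <->
  (forall eps, 0 < eps -> exists del, 0 < del /\
    forall y, 0 <= y <= 1 -> y <> x -> Rabs (y - x) < del ->
      Rabs (/ (y - x) * (r y - r x) - l) < eps).
Proof.
  split; intros h eps he; destruct (h eps he) as [del [hd H]];
    exists del; (split; [exact hd|]).
  - intros y hy hne hyx. specialize (H y). simpl in H. unfold Rdist, Rdiv in H.
    rewrite Rmult_comm. apply H. split; [split; [exact hy|auto]|exact hyx].
  - intros y [[hy hne] hyx]. simpl. unfold Rdist, Rdiv.
    rewrite Rmult_comm. apply H; auto.
Qed.

Lemma dI_const c x : dI (fun _ => c) 0 x.
Proof. apply Dconst. Qed.

Lemma dI_plus f g l m x : dI f l x -> dI g m x -> dI (fun y => f y + g y) (l + m) x.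
Proof. intros hf hg. exact (Dadd _ _ _ _ _ _ hf hg). Qed.

Lemma dI_mult f g l m x :
  dI f l x -> dI g m x -> dI (fun y => f y * g y) (l * g x + f x * m) x.
Proof. intros hf hg. exact (Dmult _ _ _ _ _ _ hf hg). Qed.

Lemma dI_minus f g l m x : dI f l x -> dI g m x -> dI (fun y => f y - g y) (l - m) x.
Proof. intros hf hg. exact (Dminus _ _ _ _ _ _ hf hg). Qed.

Lemma dI_ext_near f g l x rho : 0 < rho -> I01 x ->
  (forall y, I01 y -> Rabs (y - x) < rho -> f y = g y) -> dI f l x -> dI g l x.
Proof.
  intros hr hx h hf. apply dI_eps. intros eps he.
  apply dI_eps with (eps := eps) in hf; [|exact he].
  destruct hf as [del [hd H]]. exists (Rmin del rho).
  split; [now apply Rmin_pos|]. intros y hy hne hyx.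
  rewrite <- !h; auto.
  - apply H; auto. eapply Rlt_le_trans; [exact hyx|apply Rmin_l].
  - rewrite Rminus_diag, Rabs_R0. exact hr.
  - eapply Rlt_le_trans; [exact hyx|apply Rmin_r].
Qed.

Lemma dI_of_is_derive r l x : is_derive r x l -> dI r l x.
Proof.
  intros h. apply is_derive_Reals in h. apply dI_eps. intros eps he.
  destruct (h eps he) as [del H]. exists del. split; [apply cond_pos|].
  intros y _ hne hyx. specialize (H (y - x)).
  replace (x + (y - x)) with y in H by ring.
  rewrite Rmult_comm. apply H; [lra|exact hyx].
Qed.

Lemma dI_is_derive r l x : 0 < x < 1 -> dI r l x -> is_derive r x l.
Proof.
  intros hx h. apply is_derive_Reals. intros eps he.
  apply dI_eps with (eps := eps) in h; [|exact he]. destruct h as [del [hd H]].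
  assert (hp : 0 < Rmin del (Rmin x (1 - x))).
  { apply Rmin_pos; [exact hd|apply Rmin_pos; lra]. }
  exists (mkposreal _ hp). simpl. intros h hne hh.
  pose proof (Rmin_l del (Rmin x (1 - x))). pose proof (Rmin_r del (Rmin x (1 - x))).
  pose proof (Rmin_l x (1 - x)). pose proof (Rmin_r x (1 - x)).
  assert (hx2 : 0 <= x + h <= 1) by (destruct (Rabs_def2 h x); [lra|]; destruct (Rabs_def2 h (1 - x)); lra).
  specialize (H (x + h) hx2). replace (x + h - x) with h in H by ring.
  unfold Rdiv. rewrite Rmult_comm. apply H; lra.
Qed.

Lemma dI_cont_eps r l x : dI r l x -> forall eps, 0 < eps -> exists del, 0 < del /\
  forall y, I01 y -> Rabs (y - x) < del -> Rabs (r y - r x) < eps.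
Proof.
  intros h eps he. destruct (cont_deriv _ _ _ _ h eps he) as [del [hd H]].
  exists del. split; [exact hd|]. intros y hy hyx.
  destruct (Req_dec x y) as [<-|hne].
  - rewrite Rminus_diag. now rewrite Rabs_R0.
  - apply (H y). split; [split; assumption|exact hyx].
Qed.

Lemma dI_cont1 r d : (forall x, I01 x -> dI r (d x) x) -> cont1 r.
Proof.
  intros h. apply cont1_of_eps. intros x hx. apply dI_cont_eps with (d x). auto.
Qed.

Definition J (r : R -> R) : R := RInt (fun y => r (clamp y)) 0 1.

Lemma ex_J r a b : cont1 r -> ex_RInt (fun y => r (clamp y)) a b.
Proof. intros h. apply (ex_RInt_continuous (V := R_CompleteNormedModule)). auto. Qed.

(** [Rint] selects its value by choice, but every integrability proof yields the value [J r], and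
    continuity rules out the default branch 0. *)
Lemma J_Rint r : cont1 r -> Rint r 0 1 = J r.
Proof.
  intros h.
  assert (hex : ex_RInt r 0 1).
  { apply (ex_RInt_ext (fun y => r (clamp y))); [|now apply ex_J].
    rewrite Rmin_left, Rmax_right by lra. intros x hx.
    rewrite clamp_id; [reflexivity|unfold I01; lra]. }
  assert (heq : forall pr : Riemann_integrable r 0 1, RiemannInt pr = J r).
  { intros pr. rewrite <- (RInt_Reals r 0 1 pr). unfold J. symmetry.
    apply RInt_ext. rewrite Rmin_left, Rmax_right by lra. intros x hx.
    rewrite clamp_id; [reflexivity|unfold I01; lra]. }
  unfold Rint. destruct (ClassicalEpsilon.excluded_middle_informative _) as [e|n].
  - destruct (ClassicalEpsilon.constructive_indefinite_description _ e) as [v [pr hv]].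
    simpl. rewrite <- hv. apply heq.
  - exfalso. apply n. pose (pr := ex_RInt_Reals_0 _ _ _ hex).
    exists (RiemannInt pr), pr. reflexivity.
Qed.

Lemma J_ext f g : (forall x, I01 x -> f x = g x) -> J f = J g.
Proof. intros h. apply RInt_ext. intros x _. apply h, clamp_I01. Qed.

Lemma J_le f g : cont1 f -> cont1 g -> (forall x, 0 < x < 1 -> f x <= g x) -> J f <= J g.
Proof.
  intros hf hg h. apply RInt_le; [lra|now apply ex_J|now apply ex_J|].
  intros x hx. rewrite clamp_id by (unfold I01; lra). auto.
Qed.

Lemma J_plus f g : cont1 f -> cont1 g -> J (fun x => f x + g x) = J f + J g.
Proof. intros hf hg. apply (RInt_plus (V := R_CompleteNormedModule)); now apply ex_J. Qed.

Lemma J_minus f g : cont1 f -> cont1 g -> J (fun x => f x - g x) = J f - J g.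
Proof. intros hf hg. apply (RInt_minus (V := R_CompleteNormedModule)); now apply ex_J. Qed.

Lemma J_scal c f : cont1 f -> J (fun x => c * f x) = c * J f.
Proof. intros hf. apply (RInt_scal (V := R_CompleteNormedModule)); now apply ex_J. Qed.

Lemma J_const c : J (fun _ => c) = c.
Proof.
  unfold J. rewrite (RInt_const (V := R_CompleteNormedModule)).
  unfold scal; simpl; unfold mult; simpl. ring.
Qed.

Lemma J_ge0 f : cont1 f -> (forall x, 0 < x < 1 -> 0 <= f x) -> 0 <= J f.
Proof.
  intros hf h. rewrite <- (J_const 0). apply J_le; auto. apply cont1_const.
Qed.

Definition prim (g : R -> R) (x : R) : R := RInt (fun y => g (clamp y)) 0 x.

Lemma prim_is_derive g x : cont1 g -> is_derive (prim g) x (g (clamp x)).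
Proof.
  intros hg. apply (is_derive_RInt (V := R_NormedModule) (fun y => g (clamp y)) (prim g) 0 x).
  - exists (mkposreal 1 Rlt_0_1). intros y _.
    apply (RInt_correct (V := R_CompleteNormedModule)). now apply ex_J.
  - apply hg.
Qed.

Lemma dI_prim g x : cont1 g -> I01 x -> dI (prim g) (g x) x.
Proof.
  intros hg hx. apply dI_of_is_derive. rewrite <- (clamp_id x hx) at 2.
  now apply prim_is_derive.
Qed.

(** The mean value theorem is applied to the clamped function, which is continuous on R and
    differentiable inside (0,1). *)
Lemma dI_zero_const r : (forall x, I01 x -> dI r 0 x) ->
  forall x y, I01 x -> I01 y -> r x = r y.
Proof.
  intros h.
  assert (hc : cont1 r) by (apply dI_cont1 with (fun _ => 0); exact h).
  assert (H : forall x, I01 x -> r x = r 0).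
  { intros x hx. destruct (MVT_gen (fun y => r (clamp y)) 0 x (fun _ => 0)) as [c [_ hcx]].
    - rewrite Rmin_left, Rmax_right by apply hx. intros y hy.
      assert (hy1 : 0 < y < 1) by (unfold I01 in hx; lra).
      apply is_derive_ext_loc with r.
      + assert (hp : 0 < Rmin y (1 - y)) by (apply Rmin_pos; lra).
        exists (mkposreal _ hp). intros z hz.
        change (Rabs (z - y) < Rmin y (1 - y)) in hz.
        pose proof (Rmin_l y (1 - y)). pose proof (Rmin_r y (1 - y)).
        destruct (Rabs_def2 _ _ hz). rewrite clamp_id; [reflexivity|unfold I01; lra].
      + apply dI_is_derive; [exact hy1|apply h; unfold I01; lra].
    - intros y _. apply continuity_pt_filterlim. apply hc.
    - rewrite !clamp_id in hcx by (unfold I01 in *; lra). lra. }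
  intros x y hx hy. now rewrite (H x hx), (H y hy).
Qed.

Lemma J_FTC r d : cont1 d -> (forall x, I01 x -> dI r (d x) x) -> J d = r 1 - r 0.
Proof.
  intros hd h.
  assert (H : (fun x => prim d x - r x) 1 = (fun x => prim d x - r x) 0).
  { apply (dI_zero_const (fun x => prim d x - r x)); [|unfold I01; lra|unfold I01; lra].
    intros x hx. replace 0 with (d x - d x) by ring.
    apply dI_minus; [now apply dI_prim|auto]. }
  cbv beta in H. change (J d) with (prim d 1).
  assert (h0 : prim d 0 = 0) by (apply (RInt_point (V := R_CompleteNormedModule))).
  lra.
Qed.

(** * Complex-valued functions and L^2 bounds *)

Lemma dI_unique r l m x : I01 x -> dI r l x -> dI r m x -> l = m.
Proof.
  intros hx hl hm. destruct (Req_dec l m) as [|hne]; [assumption|exfalso].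
  assert (he : 0 < Rabs (l - m) / 2) by (apply Rdiv_lt_0_compat; [apply Rabs_pos_lt|]; lra).
  apply dI_eps with (eps := Rabs (l - m) / 2) in hl; [|exact he].
  apply dI_eps with (eps := Rabs (l - m) / 2) in hm; [|exact he].
  destruct hl as [d1 [hd1 H1]], hm as [d2 [hd2 H2]].
  set (d := Rmin (Rmin d1 d2) (1/2) / 2).
  assert (hmin : 0 < Rmin (Rmin d1 d2) (1/2)) by (repeat apply Rmin_pos; lra).
  pose proof (Rmin_l (Rmin d1 d2) (1/2)). pose proof (Rmin_r (Rmin d1 d2) (1/2)).
  pose proof (Rmin_l d1 d2). pose proof (Rmin_r d1 d2).
  (* The test point must stay in [0,1]: move right from the left half and left from the right
     half. *)
  assert (hy : exists y, I01 y /\ y <> x /\ Rabs (y - x) < d1 /\ Rabs (y - x) < d2).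
  { unfold I01 in *. destruct (Rle_dec x (1/2)).
    - exists (x + d). replace (x + d - x) with d by ring.
      rewrite Rabs_pos_eq by (unfold d; lra). unfold d; repeat split; lra.
    - exists (x - d). replace (x - d - x) with (- d) by ring.
      rewrite Rabs_Ropp, Rabs_pos_eq by (unfold d; lra). unfold d; repeat split; lra. }
  destruct hy as [y [hy [hyx [hy1 hy2]]]].
  specialize (H1 y hy hyx hy1). specialize (H2 y hy hyx hy2).
  set (q := / (y - x) * (r y - r x)) in *.
  assert (Rabs (l - m) <= Rabs (q - m) + Rabs (q - l)); [|lra].
  replace (l - m) with ((q - m) - (q - l)) by ring.
  eapply Rle_trans; [apply Rabs_triang|]. rewrite Rabs_Ropp. lra.
Qed.

Lemma Cx_eq z w : Re z = Re w -> Im z = Im w -> z = w.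
Proof. destruct z, w; simpl; now intros -> ->. Qed.

Lemma Cnorm2_ge0 z : 0 <= Cnorm2 z.
Proof. unfold Cnorm2. pose proof (pow2_ge_0 (Re z)). pose proof (pow2_ge_0 (Im z)). lra. Qed.

Lemma Cabs_sqr z : Cabs z ^ 2 = Cnorm2 z.
Proof. unfold Cabs. apply pow2_sqrt, Cnorm2_ge0. Qed.

Lemma Cabs_ge0 z : 0 <= Cabs z.
Proof. apply sqrt_pos. Qed.

Lemma Re_le_Cabs z : Rabs (Re z) <= Cabs z.
Proof. rewrite <- sqrt_Rsqr_abs. apply sqrt_le_1_alt. unfold Cnorm2, Rsqr. nra. Qed.

Lemma Im_le_Cabs z : Rabs (Im z) <= Cabs z.
Proof. rewrite <- sqrt_Rsqr_abs. apply sqrt_le_1_alt. unfold Cnorm2, Rsqr. nra. Qed.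

Lemma Cabs_le_sum z : Cabs z <= Rabs (Re z) + Rabs (Im z).
Proof.
  pose proof (Rabs_pos (Re z)). pose proof (Rabs_pos (Im z)).
  rewrite <- (sqrt_pow2 (Rabs (Re z) + Rabs (Im z))) by lra.
  apply sqrt_le_1_alt. unfold Cnorm2.
  rewrite <- (pow2_abs (Re z)), <- (pow2_abs (Im z)). nra.
Qed.

Lemma has_deriv01_dI g l x : has_deriv01 g l x <->
  dI (fun y => Re (g y)) (Re l) x /\ dI (fun y => Im (g y)) (Im l) x.
Proof.
  split.
  - intros h. split; apply dI_eps; intros eps he; destruct (h eps he) as [del [hd H]];
      exists del; (split; [exact hd|]); intros y hy hne hyx;
      (eapply Rle_lt_trans; [|apply (H y hy hne hyx)]).
    + apply (Re_le_Cabs (Csub (Cscal (/ (y - x)) (Csub (g y) (g x))) l)).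
    + apply (Im_le_Cabs (Csub (Cscal (/ (y - x)) (Csub (g y) (g x))) l)).
  - intros [hr hi] eps he.
    apply dI_eps with (eps := eps / 2) in hr; [|lra].
    apply dI_eps with (eps := eps / 2) in hi; [|lra].
    destruct hr as [d1 [hd1 H1]], hi as [d2 [hd2 H2]].
    pose proof (Rmin_l d1 d2). pose proof (Rmin_r d1 d2).
    exists (Rmin d1 d2). split; [now apply Rmin_pos|]. intros y hy hne hyx.
    eapply Rle_lt_trans; [apply Cabs_le_sum|]. simpl.
    specialize (H1 y hy hne ltac:(lra)). specialize (H2 y hy hne ltac:(lra)). lra.
Qed.

Lemma has_deriv01_add g h l m x : has_deriv01 g l x -> has_deriv01 h m x ->
  has_deriv01 (fun y => Cadd (g y) (h y)) (Cadd l m) x.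
Proof.
  intros hg hh. apply has_deriv01_dI in hg as [], hh as [].
  apply has_deriv01_dI. split; simpl; now apply dI_plus.
Qed.

Lemma has_deriv01_sub g h l m x : has_deriv01 g l x -> has_deriv01 h m x ->
  has_deriv01 (fun y => Csub (g y) (h y)) (Csub l m) x.
Proof.
  intros hg hh. apply has_deriv01_dI in hg as [], hh as [].
  apply has_deriv01_dI. split; simpl; now apply dI_minus.
Qed.

Lemma has_deriv01_mul g h l m x : has_deriv01 g l x -> has_deriv01 h m x ->
  has_deriv01 (fun y => Cmul (g y) (h y)) (Cadd (Cmul l (h x)) (Cmul (g x) m)) x.
Proof.
  intros hg hh. apply has_deriv01_dI in hg as [a b], hh as [c d].
  apply has_deriv01_dI. split; simpl.
  - pose proof (dI_minus _ _ _ _ _ (dI_mult _ _ _ _ _ a c) (dI_mult _ _ _ _ _ b d)) as H.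
    cbv beta in H. match type of H with dI _ ?v _ => match goal with |- dI _ ?w _ =>
      replace w with v by ring end end. exact H.
  - pose proof (dI_plus _ _ _ _ _ (dI_mult _ _ _ _ _ a d) (dI_mult _ _ _ _ _ b c)) as H.
    cbv beta in H. match type of H with dI _ ?v _ => match goal with |- dI _ ?w _ =>
      replace w with v by ring end end. exact H.
Qed.

Lemma has_deriv01_scal r k g l x : dI r k x -> has_deriv01 g l x ->
  has_deriv01 (fun y => Cscal (r y) (g y)) (Cadd (Cscal k (g x)) (Cscal (r x) l)) x.
Proof.
  intros hr hg. apply has_deriv01_dI in hg as [a b].
  apply has_deriv01_dI. split; simpl; [exact (dI_mult _ _ _ _ _ hr a)|exact (dI_mult _ _ _ _ _ hr b)].
Qed.

Lemma has_deriv01_const c x : has_deriv01 (fun _ => c) C0 x.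
Proof. apply has_deriv01_dI. split; simpl; apply dI_const. Qed.

Lemma has_deriv01_ext_near f g l x rho : 0 < rho -> I01 x ->
  (forall y, I01 y -> Rabs (y - x) < rho -> f y = g y) -> has_deriv01 f l x -> has_deriv01 g l x.
Proof.
  intros hr hx h hf. apply has_deriv01_dI in hf as [a b]. apply has_deriv01_dI.
  split; [apply (dI_ext_near (fun y => Re (f y)) _ _ x rho)|
          apply (dI_ext_near (fun y => Im (f y)) _ _ x rho)]; auto; intros; now rewrite h.
Qed.

Lemma has_deriv01_unique g l m x : I01 x -> has_deriv01 g l x -> has_deriv01 g m x -> l = m.
Proof.
  intros hx hl hm. apply has_deriv01_dI in hl as [], hm as [].
  apply Cx_eq; eapply dI_unique; eauto.
Qed.

(** This carries the support condition from [u] to [u'], then to [f] and all its derivatives. *)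
Lemma has_deriv01_zero_left g g' delta :
  (forall x, I01 x -> has_deriv01 g (g' x) x) ->
  (forall x, I01 x -> x < delta -> g x = C0) ->
  forall x, I01 x -> x < delta -> g' x = C0.
Proof.
  intros hd h0 x hx hxd.
  apply (has_deriv01_unique g _ _ x hx (hd x hx)).
  apply (has_deriv01_ext_near (fun _ => C0) g _ x (delta - x)); [lra|exact hx| |apply has_deriv01_const].
  intros y hy hyx. symmetry. apply h0; [exact hy|]. apply Rabs_def2 in hyx. lra.
Qed.

Definition contI (g : R -> Cx) : Prop :=
  cont1 (fun x => Re (g x)) /\ cont1 (fun x => Im (g x)).

Lemma has_deriv01_contI g d : (forall x, I01 x -> has_deriv01 g (d x) x) -> contI g.
Proof.
  intros h. split; [apply dI_cont1 with (fun x => Re (d x))|apply dI_cont1 with (fun x => Im (d x))];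
    intros x hx; apply has_deriv01_dI, h, hx.
Qed.

Lemma contI_add g h : contI g -> contI h -> contI (fun x => Cadd (g x) (h x)).
Proof. intros [a b] [c d]. split; now apply cont1_plus. Qed.

Lemma contI_sub g h : contI g -> contI h -> contI (fun x => Csub (g x) (h x)).
Proof. intros [a b] [c d]. split; now apply cont1_minus. Qed.

Lemma contI_mul g h : contI g -> contI h -> contI (fun x => Cmul (g x) (h x)).
Proof.
  intros [a b] [c d]. split; simpl.
  - apply cont1_minus; now apply cont1_mult.
  - apply cont1_plus; now apply cont1_mult.
Qed.

Lemma contI_scal r g : cont1 r -> contI g -> contI (fun x => Cscal (r x) (g x)).
Proof. intros hr [a b]. split; simpl; now apply cont1_mult. Qed.

Lemma contI_const z : contI (fun _ => z).
Proof. split; apply cont1_const. Qed.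

Lemma contI_ext f g : (forall x, I01 x -> f x = g x) -> contI f -> contI g.
Proof.
  intros h [a b]. split; [apply (cont1_ext (fun x => Re (f x)))|apply (cont1_ext (fun x => Im (f x)))];
    auto; intros x hx; now rewrite h.
Qed.

Lemma cont1_Cnorm2 g : contI g -> cont1 (fun x => Cnorm2 (g x)).
Proof.
  intros [a b]. unfold Cnorm2.
  apply (cont1_plus (fun x => Re (g x) ^ 2) (fun x => Im (g x) ^ 2)); now apply cont1_pow.
Qed.

(** An L^2 norm bound in squared form. Continuity is bundled in so that [J] really computes the
    integral, and [0 <= A] because bounds are compared after squaring. *)
Definition l2le (g : R -> Cx) (A : R) : Prop :=
  contI g /\ 0 <= A /\ J (fun x => Cnorm2 (g x)) <= A ^ 2.

Lemma l2le_mono g A B : l2le g A -> A <= B -> l2le g B.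
Proof.
  intros [hc [hA h]] hAB. split; [exact hc|split; [lra|]].
  eapply Rle_trans; [exact h|]. now apply pow_incr.
Qed.

Lemma l2le_ext f g A : (forall x, I01 x -> f x = g x) -> l2le f A -> l2le g A.
Proof.
  intros h [hc [hA hf]]. split; [now apply (contI_ext f)|split; [exact hA|]].
  rewrite (J_ext _ (fun x => Cnorm2 (f x))); [exact hf|]. intros x hx. now rewrite h.
Qed.

(** In [l2le_add] the quotients of the two bounds serve as weights, so a slack [e] first makes both
    positive; here the slack is removed. For [e <= 1] it costs at most [e (2A+1)]. *)
Lemma sq_le_of_eps X A : (forall e, 0 < e -> X <= (A + e) ^ 2) -> 0 <= A -> X <= A ^ 2.
Proof.
  intros h hA. apply le_epsilon. intros eps he.
  set (e := Rmin 1 (eps / (2 * A + 1))).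
  assert (hp : 0 < eps / (2 * A + 1)) by (apply Rdiv_lt_0_compat; lra).
  assert (he1 : 0 < e) by (apply Rmin_pos; lra).
  assert (e <= 1) by apply Rmin_l. assert (e <= eps / (2 * A + 1)) by apply Rmin_r.
  assert (e * (2 * A + 1) <= eps).
  { apply Rle_trans with (eps / (2 * A + 1) * (2 * A + 1)); [apply Rmult_le_compat_r; lra|].
    right. field. lra. }
  specialize (h e he1). nra.
Qed.

(* For A, B > 0, |g+h|^2 <= (1+B/A)|g|^2 + (1+A/B)|h|^2, whose integral is at most (A+B)^2. *)
Lemma l2le_add g h A B : l2le g A -> l2le h B -> l2le (fun x => Cadd (g x) (h x)) (A + B).
Proof.
  intros [hcg [hA hg]] [hch [hB hh]].
  split; [now apply contI_add|split; [lra|]].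
  apply sq_le_of_eps; [|lra]. intros e he.
  set (a := A + e / 2). set (b := B + e / 2).
  assert (ha : 0 < a) by (unfold a; lra). assert (hb : 0 < b) by (unfold b; lra).
  assert (hg' : J (fun x => Cnorm2 (g x)) <= a ^ 2)
    by (eapply Rle_trans; [exact hg|apply pow_incr; unfold a; lra]).
  assert (hh' : J (fun x => Cnorm2 (h x)) <= b ^ 2)
    by (eapply Rle_trans; [exact hh|apply pow_incr; unfold b; lra]).
  assert (cg := cont1_Cnorm2 g hcg). assert (ch := cont1_Cnorm2 h hch).
  replace (A + B + e) with (a + b) by (unfold a, b; lra).
  assert (hab : 0 < b / a) by now apply Rdiv_lt_0_compat.
  assert (hba : 0 < a / b) by now apply Rdiv_lt_0_compat.
  assert (c1 : cont1 (fun x => (1 + b / a) * Cnorm2 (g x)))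
    by (apply (cont1_mult (fun _ => 1 + b / a)); [apply cont1_const|exact cg]).
  assert (c2 : cont1 (fun x => (1 + a / b) * Cnorm2 (h x)))
    by (apply (cont1_mult (fun _ => 1 + a / b)); [apply cont1_const|exact ch]).
  apply Rle_trans with (J (fun x => (1 + b / a) * Cnorm2 (g x) + (1 + a / b) * Cnorm2 (h x))).
  - apply J_le; [apply cont1_Cnorm2; now apply contI_add|now apply cont1_plus|].
    intros x _. unfold Cnorm2, Cadd; simpl Re; simpl Im.
    assert (sq : forall p q : R, (p + q) ^ 2 <= (1 + b / a) * p ^ 2 + (1 + a / b) * q ^ 2).
    { intros p q.
      assert (E : (1 + b / a) * p ^ 2 + (1 + a / b) * q ^ 2 - (p + q) ^ 2
                  = (b * p - a * q) ^ 2 * / (a * b)) by (field; lra).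
      pose proof (pow2_ge_0 (b * p - a * q)).
      assert (0 <= (b * p - a * q) ^ 2 * / (a * b)); [|lra].
      apply Rmult_le_pos; [assumption|]. left. apply Rinv_0_lt_compat. nra. }
    pose proof (sq (Re (g x)) (Re (h x))). pose proof (sq (Im (g x)) (Im (h x))). lra.
  - rewrite J_plus, !J_scal by assumption.
    apply Rle_trans with ((1 + b / a) * a ^ 2 + (1 + a / b) * b ^ 2).
    + apply Rplus_le_compat; apply Rmult_le_compat_l; lra.
    + right. field. lra.
Qed.

Lemma l2le_mul p g K A : contI p -> 0 <= K -> (forall x, 0 < x < 1 -> Cabs (p x) <= K) ->
  l2le g A -> l2le (fun x => Cmul (p x) (g x)) (K * A).
Proof.
  intros hp hK hb [hc [hA h]]. split; [now apply contI_mul|split; [now apply Rmult_le_pos|]].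
  assert (c := cont1_Cnorm2 g hc).
  apply Rle_trans with (J (fun x => K ^ 2 * Cnorm2 (g x))).
  - apply J_le; [apply cont1_Cnorm2; now apply contI_mul|
      apply (cont1_mult (fun _ => K ^ 2)); [apply cont1_const|exact c]|].
    intros x hx. replace (Cnorm2 (Cmul (p x) (g x))) with (Cnorm2 (p x) * Cnorm2 (g x))
      by (unfold Cnorm2, Cmul; simpl; ring).
    apply Rmult_le_compat_r; [apply Cnorm2_ge0|]. rewrite <- Cabs_sqr.
    apply pow_incr. split; [apply Cabs_ge0|auto].
  - rewrite J_scal by exact c. rewrite Rpow_mult_distr.
    apply Rmult_le_compat_l; [apply pow2_ge_0|exact h].
Qed.

Lemma l2le_scal k g A : l2le g A -> l2le (fun x => Cscal k (g x)) (Rabs k * A).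
Proof.
  intros h. apply (l2le_ext (fun x => Cmul (mkCx k 0) (g x))).
  - intros x _. unfold Cmul, Cscal; simpl. apply Cx_eq; simpl; ring.
  - apply l2le_mul; [apply contI_const|apply Rabs_pos| |exact h].
    intros x _. eapply Rle_trans; [apply Cabs_le_sum|]. simpl. rewrite Rabs_R0. lra.
Qed.

Lemma l2le_sub g h A B : l2le g A -> l2le h B -> l2le (fun x => Csub (g x) (h x)) (A + B).
Proof.
  intros hg hh. apply (l2le_ext (fun x => Cadd (g x) (Cscal (-1) (h x)))).
  - intros x _. apply Cx_eq; simpl; ring.
  - replace B with (Rabs (-1) * B) by (rewrite Rabs_left; lra).
    apply l2le_add; [exact hg|now apply l2le_scal].
Qed.

(** * Smooth test functions and the lemma of du Bois-Reymond *)

(** Polynomials as syntax: [pder] returns a term again, so the derivatives of the bump of all orders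
    can be produced by recursion. *)
Inductive pexp : Type :=
| PC (c : R) | PX | PA (p q : pexp) | PM (p q : pexp).

Fixpoint peval (p : pexp) (x : R) : R :=
  match p with
  | PC c => c
  | PX => x
  | PA p q => peval p x + peval q x
  | PM p q => peval p x * peval q x
  end.

Fixpoint pder (p : pexp) : pexp :=
  match p with
  | PC _ => PC 0
  | PX => PC 1
  | PA p q => PA (pder p) (pder q)
  | PM p q => PA (PM (pder p) q) (PM p (pder q))
  end.

Lemma peval_is_derive p x : is_derive (peval p) x (peval (pder p) x).
Proof.
  induction p as [c| |p hp q hq|p hp q hq]; simpl.
  - apply (is_derive_const (V := R_NormedModule)).
  - apply (is_derive_id (K := R_AbsRing)).
  - apply (is_derive_plus (V := R_NormedModule)); assumption.
  - apply (is_derive_mult (K := R_AbsRing) (peval p) (peval q)); auto. intros; apply Rmult_comm.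
Qed.

Lemma peval_bounded p : exists M, 0 <= M /\ forall x, I01 x -> Rabs (peval p x) <= M.
Proof.
  induction p as [c| |p [M [hM hp]] q [N [hN hq]]|p [M [hM hp]] q [N [hN hq]]]; simpl.
  - exists (Rabs c). split; [apply Rabs_pos|]. intros; lra.
  - exists 1. split; [lra|]. intros x [h0 h1]. rewrite Rabs_pos_eq; lra.
  - exists (M + N). split; [lra|]. intros x hx.
    eapply Rle_trans; [apply Rabs_triang|]. apply Rplus_le_compat; auto.
  - exists (M * N). split; [nra|]. intros x hx. rewrite Rabs_mult.
    apply Rmult_le_compat; auto using Rabs_pos.
Qed.

Definition pq : pexp := PM PX (PA (PC 1) (PM (PC (-1)) PX)).

(* The derivatives of exp(-1/(x(1-x))) all lie in this family; off (0,1) the value is 0. *)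
Definition bump (p : pexp) (m : nat) (x : R) : R :=
  if Rlt_dec 0 x then
    if Rlt_dec x 1 then peval p x * (/ (x * (1 - x))) ^ m * exp (- / (x * (1 - x))) else 0
  else 0.

(** With [q = x(1-x)] and [v = 1/q] one has [v' = -q' v^2], so the derivative of [p v^m exp(-v)] is
    [(p' q^2 + p q' (1 - m q)) v^(m+2) exp(-v)]. *)
Definition bump_der (p : pexp) (m : nat) : pexp :=
  PA (PM (pder p) (PM pq pq))
     (PM (PM p (pder pq)) (PA (PC 1) (PM (PC (- INR m)) pq))).

Lemma bump_in p m x : 0 < x < 1 ->
  bump p m x = peval p x * (/ (x * (1 - x))) ^ m * exp (- / (x * (1 - x))).
Proof.
  intros [h0 h1]. unfold bump.
  destruct (Rlt_dec 0 x); [|lra]. destruct (Rlt_dec x 1); [reflexivity|lra].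
Qed.

Lemma bump_out p m x : x <= 0 \/ 1 <= x -> bump p m x = 0.
Proof.
  intros h. unfold bump.
  destruct (Rlt_dec 0 x); [|reflexivity]. destruct (Rlt_dec x 1); [lra|reflexivity].
Qed.

Lemma bump_is_derive_in p m x : 0 < x < 1 ->
  is_derive (bump p m) x (bump (bump_der p m) (m + 2) x).
Proof.
  intros hx.
  apply is_derive_ext_loc with
    (fun x => peval p x * (/ (x * (1 - x))) ^ m * exp (- / (x * (1 - x)))).
  { assert (hp : 0 < Rmin x (1 - x)) by (apply Rmin_pos; lra).
    exists (mkposreal _ hp). intros y hy. change (Rabs (y - x) < Rmin x (1 - x)) in hy.
    pose proof (Rmin_l x (1 - x)). pose proof (Rmin_r x (1 - x)).
    destruct (Rabs_def2 _ _ hy). symmetry. apply bump_in. lra. }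
  assert (hq : 0 < x * (1 - x)) by nra.
  rewrite bump_in by exact hx.
  auto_derive.
  - repeat split; try nra. eexists; apply peval_is_derive.
  - match goal with |- context [Derive ?f x] =>
      replace (Derive f x) with (peval (pder p) x)
        by (symmetry; apply is_derive_unique, peval_is_derive) end.
    unfold bump_der, pq. simpl peval. change (1 + - x) with (1 - x). set (v := / (x * (1 - x))).
    assert (hv : v * (x * (1 - x)) = 1) by (unfold v; field; lra).
    assert (hn : x * (1 - x) <> 0) by lra.
    rewrite pow_add. destruct m as [|m]; simpl (pred _).
    + simpl. unfold v; field; nra.
    + replace (v ^ S m) with (v ^ m * v) by (simpl; ring).
      generalize (v ^ m) (exp (- v)). intros a b.
      unfold v; field; nra.
Qed.

Lemma pow_le_exp t n : 0 <= t -> t ^ n <= INR (fact n) * exp t.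
Proof.
  intros ht. pose proof (exp_ge_taylor t n ht) as h.
  pose proof (INR_fact_lt_0 n) as hf.
  assert (h1 : t ^ n / INR (fact n) <= sum_f_R0 (fun k => t ^ k / INR (fact k)) n).
  { destruct n as [|n]; [simpl; lra|]. rewrite tech5.
    assert (0 <= sum_f_R0 (fun k => t ^ k / INR (fact k)) n); [|lra].
    apply cond_pos_sum. intros k. apply Rdiv_le_0_compat; [now apply pow_le|apply INR_fact_lt_0]. }
  apply Rmult_le_reg_l with (/ INR (fact n)); [now apply Rinv_0_lt_compat|].
  rewrite <- Rmult_assoc, Rinv_l, Rmult_1_l by lra. unfold Rdiv in h1. lra.
Qed.

(** For [y] in (0,1), [q = y(1-y)] is at most the distance from [y] to [x], and
    [t^(m+2) <= (m+2)! exp(t)] at [t = 1/q] bounds [q^-m exp(-1/q)] by a multiple of [q^2]. A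
    quadratic bound gives derivative 0 at [x], end points included. *)
Lemma bump_quadratic p m x : x <= 0 \/ 1 <= x ->
  exists K, 0 < K /\ forall y, Rabs (bump p m y) <= K * (y - x) ^ 2.
Proof.
  intros hx. destruct (peval_bounded p) as [M [hM hp]].
  pose proof (INR_fact_lt_0 (m + 2)) as hf.
  exists ((M + 1) * INR (fact (m + 2))). split; [nra|]. intros y.
  destruct (Rlt_dec 0 y); [destruct (Rlt_dec y 1)|].
  2,3: rewrite bump_out, Rabs_R0 by lra; apply Rmult_le_pos; [nra|apply pow2_ge_0].
  rewrite bump_in by lra. rewrite !Rabs_mult.
  assert (hq : 0 < y * (1 - y)) by nra.
  set (q := y * (1 - y)) in *. assert (hv : 0 < / q) by now apply Rinv_0_lt_compat.
  rewrite (Rabs_pos_eq (_ ^ m)) by (apply pow_le; lra).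
  rewrite (Rabs_pos_eq (exp _)) by (left; apply exp_pos).
  assert (hyx : q ^ 2 <= (y - x) ^ 2).
  { destruct hx.
    - apply pow_incr. unfold q. nra.
    - replace ((y - x) ^ 2) with ((x - y) ^ 2) by ring. apply pow_incr. unfold q. nra. }
  assert (h1 : (/ q) ^ m * exp (- / q) <= INR (fact (m + 2)) * q ^ 2).
  { pose proof (pow_le_exp (/ q) (m + 2) (Rlt_le _ _ hv)) as h.
    rewrite pow_add in h. rewrite exp_Ropp. pose proof (exp_pos (/ q)).
    apply Rmult_le_reg_r with (exp (/ q)); [assumption|].
    rewrite Rmult_assoc, Rinv_l, Rmult_1_r by lra.
    apply Rmult_le_compat_r with (r := q ^ 2) in h; [|apply pow2_ge_0].
    replace ((/ q) ^ m * (/ q) ^ 2 * q ^ 2) with ((/ q) ^ m) in h by (field; lra).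
    lra. }
  rewrite Rmult_assoc.
  apply Rle_trans with (M * (INR (fact (m + 2)) * q ^ 2)).
  - apply Rmult_le_compat; auto using Rabs_pos.
    + apply Rmult_le_pos; [apply pow_le; lra|left; apply exp_pos].
    + apply hp. unfold I01; lra.
  - pose proof (pow2_ge_0 q).
    apply Rle_trans with (M * (INR (fact (m + 2)) * (y - x) ^ 2)).
    + apply Rmult_le_compat_l; [exact hM|]. apply Rmult_le_compat_l; lra.
    + pose proof (pow2_ge_0 (y - x)).
      assert (0 <= INR (fact (m + 2)) * (y - x) ^ 2) by (apply Rmult_le_pos; lra). lra.
Qed.

Lemma bump_is_derive p m x : is_derive (bump p m) x (bump (bump_der p m) (m + 2) x).
Proof.
  destruct (Rlt_dec 0 x); [destruct (Rlt_dec x 1)|]; [now apply bump_is_derive_in| |].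
  all: rewrite bump_out by lra.
  all: destruct (bump_quadratic p m x) as [K [hK H]]; [lra|].
  all: apply is_derive_Reals; intros eps he.
  all: assert (hp : 0 < eps / K) by (now apply Rdiv_lt_0_compat).
  all: exists (mkposreal _ hp); simpl; intros h hne hh.
  all: rewrite (bump_out p m x) by lra; rewrite !Rminus_0_r; unfold Rdiv; rewrite Rabs_mult, Rabs_inv.
  all: specialize (H (x + h)); replace (x + h - x) with h in H by ring.
  all: pose proof (Rabs_pos_lt h hne) as ha.
  all: apply Rmult_lt_reg_r with (Rabs h); [exact ha|].
  all: rewrite Rmult_assoc, Rinv_l, Rmult_1_r by lra.
  all: rewrite <- pow2_abs in H; eapply Rle_lt_trans; [exact H|].
  all: apply Rmult_lt_compat_l with (r := K) in hh; [|exact hK].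
  all: replace (K * (eps / K)) with eps in hh by (field; lra); nra.
Qed.

Fixpoint bump_data (n : nat) : pexp * nat :=
  match n with
  | O => (PC 1, O)
  | S n => (bump_der (fst (bump_data n)) (snd (bump_data n)), (snd (bump_data n) + 2)%nat)
  end.

Definition bumpn (n : nat) : R -> R := bump (fst (bump_data n)) (snd (bump_data n)).

Lemma bumpn_is_derive n x : is_derive (bumpn n) x (bumpn (S n) x).
Proof. apply bump_is_derive. Qed.

Lemma bumpn_out n x : x <= 0 \/ 1 <= x -> bumpn n x = 0.
Proof. apply bump_out. Qed.

Lemma bumpn_continuous n x : continuous (bumpn n) x.
Proof. apply (ex_derive_continuous (V := R_NormedModule)). eexists. apply bumpn_is_derive. Qed.

Lemma bumpn0_pos x : 0 < x < 1 -> 0 < bumpn 0 x.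
Proof.
  intros hx. unfold bumpn. rewrite bump_in by exact hx. simpl.
  rewrite !Rmult_1_l. apply exp_pos.
Qed.

Lemma bumpn0_ge0 x : 0 <= bumpn 0 x.
Proof.
  destruct (Rlt_dec 0 x); [destruct (Rlt_dec x 1)|].
  - left. now apply bumpn0_pos.
  - rewrite bumpn_out; lra.
  - rewrite bumpn_out; lra.
Qed.

Definition step (x : R) : R := RInt (bumpn 0) 0 x.

Lemma ex_RInt_bumpn a b : ex_RInt (bumpn 0) a b.
Proof. apply (ex_RInt_continuous (V := R_CompleteNormedModule)). intros; apply bumpn_continuous. Qed.

Lemma step_is_derive x : is_derive step x (bumpn 0 x).
Proof.
  apply (is_derive_RInt (V := R_NormedModule) (bumpn 0) step 0 x).
  - exists (mkposreal 1 Rlt_0_1). intros y _.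
    apply (RInt_correct (V := R_CompleteNormedModule)), ex_RInt_bumpn.
  - apply bumpn_continuous.
Qed.

Lemma RInt_zero (g : R -> R) a b :
  (forall x, Rmin a b < x < Rmax a b -> g x = 0) -> RInt g a b = 0.
Proof.
  intros h. rewrite (RInt_ext _ (fun _ => 0)) by exact h.
  rewrite (RInt_const (V := R_CompleteNormedModule)). apply Rmult_0_r.
Qed.

Lemma step_neg x : x <= 0 -> step x = 0.
Proof.
  intros hx. apply RInt_zero. rewrite Rmin_right, Rmax_left by lra.
  intros y hy. apply bumpn_out. lra.
Qed.

Lemma step_ge1 x : 1 <= x -> step x = step 1.
Proof.
  intros hx. unfold step.
  rewrite <- (RInt_Chasles (V := R_CompleteNormedModule) (bumpn 0) 0 1 x) by apply ex_RInt_bumpn.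
  rewrite (RInt_zero _ 1 x).
  - apply Rplus_0_r.
  - rewrite Rmin_left, Rmax_right by lra. intros y hy. apply bumpn_out. lra.
Qed.

Lemma step1_pos : 0 < step 1.
Proof.
  apply RInt_gt_0; [lra|apply bumpn0_pos|]. intros; apply bumpn_continuous.
Qed.

(** The first derivative is a difference of two translates of one bump, so pairing it with [h]
    compares averages of [h] just right of [a] and just right of [b]. *)
Definition plateau (a b e : R) (n : nat) (x : R) : R :=
  match n with
  | O => step ((x - a) / e) - step ((x - b) / e)
  | S n => (/ e) ^ S n * (bumpn n ((x - a) / e) - bumpn n ((x - b) / e))
  end.

Lemma is_derive_affine (g : R -> R) (a e x l : R) :
  e <> 0 -> is_derive g ((x - a) / e) l -> is_derive (fun y => g ((y - a) / e)) x (/ e * l).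
Proof.
  intros he h.
  apply (is_derive_comp (V := R_NormedModule) g (fun y => (y - a) / e) x l (/ e)); [exact h|].
  auto_derive; [trivial|field; exact he].
Qed.

Lemma plateau_test a b e : 0 < a -> a < b -> 0 < e -> b + e < 1 -> test_fun (plateau a b e).
Proof.
  intros ha hab he hb. split.
  - intros n x. apply is_derive_Reals. destruct n as [|n]; simpl.
    + rewrite Rmult_1_r, Rmult_minus_distr_l.
      apply (is_derive_minus (V := R_NormedModule)); apply is_derive_affine;
        try lra; apply step_is_derive.
    + replace (/ e * (/ e * (/ e) ^ n) *
        (bumpn (S n) ((x - a) / e) - bumpn (S n) ((x - b) / e))) with
        ((/ e * (/ e) ^ n) * (/ e * bumpn (S n) ((x - a) / e) - / e * bumpn (S n) ((x - b) / e)))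
        by ring.
      apply (is_derive_scal (fun x => bumpn n ((x - a) / e) - bumpn n ((x - b) / e))).
      apply (is_derive_minus (V := R_NormedModule)); apply is_derive_affine;
        try lra; apply bumpn_is_derive.
  - exists a, (b + e). repeat split; try lra. intros x hx. simpl.
    assert (hi : 0 < / e) by now apply Rinv_0_lt_compat.
    destruct hx as [hx|hx].
    + rewrite !step_neg; [ring| |]; unfold Rdiv; nra.
    + assert (h1 : 1 <= (x - b) / e) by (apply Rle_div_r; lra).
      assert (h2 : 1 <= (x - a) / e) by (apply Rle_div_r; lra).
      rewrite !(step_ge1 _ h1), (step_ge1 _ h2). ring.
Qed.

Lemma cont1_bump_affine a e : e <> 0 -> cont1 (fun x => bumpn 0 ((x - a) / e)).
Proof.
  intros he. apply cont1_continuous. intros x.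
  apply (ex_derive_continuous (V := R_NormedModule)). eexists.
  apply is_derive_affine; [exact he|apply bumpn_is_derive].
Qed.

Lemma J_bump_affine a e : 0 < a -> 0 < e -> a + e < 1 ->
  J (fun x => bumpn 0 ((x - a) / e)) = e * step 1.
Proof.
  intros ha he hb.
  rewrite (J_FTC (fun x => e * step ((x - a) / e))).
  - assert (hi : 0 < / e) by now apply Rinv_0_lt_compat.
    rewrite step_ge1 by (apply Rle_div_r; lra).
    rewrite (step_neg ((0 - a) / e)) by (unfold Rdiv; nra). ring.
  - apply cont1_bump_affine. lra.
  - intros x _. apply dI_of_is_derive.
    replace (bumpn 0 ((x - a) / e)) with (e * (/ e * bumpn 0 ((x - a) / e))) by (field; lra).
    apply (is_derive_scal (fun x => step ((x - a) / e))).
    apply is_derive_affine; [lra|apply step_is_derive].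
Qed.

(** The bump lives on [[a,a+e]], where [h] is within [eta] of [h a], and its mass is [e] times
    [step 1]. *)
Lemma bump_average h a e eta : cont1 h -> 0 < a -> 0 < e -> a + e < 1 ->
  (forall x, I01 x -> Rabs (x - a) <= e -> Rabs (h x - h a) <= eta) ->
  Rabs (J (fun x => bumpn 0 ((x - a) / e) * h x) - h a * (e * step 1)) <= eta * (e * step 1).
Proof.
  intros hc ha he hb hh.
  assert (hB := cont1_bump_affine a e (Rgt_not_eq _ _ he)).
  rewrite <- (J_bump_affine a e ha he hb).
  assert (key : forall x, 0 < x < 1 ->
    (h a - eta) * bumpn 0 ((x - a) / e) <= bumpn 0 ((x - a) / e) * h x
      <= (h a + eta) * bumpn 0 ((x - a) / e)).
  { intros x hx. pose proof (bumpn0_ge0 ((x - a) / e)) as hp.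
    destruct (Rle_dec (Rabs (x - a)) e) as [hle|hgt].
    - assert (hx1 : I01 x) by (unfold I01; lra).
      specialize (hh x hx1 hle). apply Rabs_le_between in hh. nra.
    - assert (hz : bumpn 0 ((x - a) / e) = 0).
      { apply bumpn_out. assert (hi : 0 < / e) by now apply Rinv_0_lt_compat.
        revert hgt. unfold Rabs. destruct (Rcase_abs (x - a)); intros hgt.
        - left. unfold Rdiv. nra.
        - right. apply Rle_div_r; lra. }
      rewrite hz. lra. }
  assert (h1 : J (fun x => (h a - eta) * bumpn 0 ((x - a) / e))
               <= J (fun x => bumpn 0 ((x - a) / e) * h x)).
  { apply J_le; [apply (cont1_mult (fun _ => h a - eta)); [apply cont1_const|exact hB]|
      now apply cont1_mult|intros x hx; apply key; exact hx]. }
  assert (h2 : J (fun x => bumpn 0 ((x - a) / e) * h x)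
               <= J (fun x => (h a + eta) * bumpn 0 ((x - a) / e))).
  { apply J_le; [now apply cont1_mult|
      apply (cont1_mult (fun _ => h a + eta)); [apply cont1_const|exact hB]|
      intros x hx; apply key; exact hx]. }
  rewrite J_scal in h1, h2 by exact hB. apply Rabs_le. lra.
Qed.

Lemma test_fun_cont1 P n : test_fun P -> cont1 (P n).
Proof.
  intros [hd _]. apply cont1_continuous. intros x.
  apply (ex_derive_continuous (V := R_NormedModule)). eexists. apply is_derive_Reals, hd.
Qed.

Lemma duBoisReymond h : cont1 h ->
  (forall P, test_fun P -> J (fun x => P 1%nat x * h x) = 0) ->
  forall a b, 0 < a -> a < b -> b < 1 -> h a = h b.
Proof.
  intros hc hP a b ha hab hb.
  destruct (Req_dec (h a) (h b)) as [|hne]; [assumption|exfalso].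
  (* The two averages coincide and each is within [eta] of its value, so [|h a - h b| <= 2 eta],
     which is half of the left side. *)
  set (eta := Rabs (h a - h b) / 4).
  assert (heta : 0 < eta) by (apply Rdiv_lt_0_compat; [apply Rabs_pos_lt; lra|lra]).
  destruct (cont1_eps h a hc) with (eps := eta) as [da [hda Ha]]; [unfold I01; lra|exact heta|].
  destruct (cont1_eps h b hc) with (eps := eta) as [db [hdb Hb]]; [unfold I01; lra|exact heta|].
  set (e := Rmin (Rmin da db) (1 - b) / 2).
  assert (hmin : 0 < Rmin (Rmin da db) (1 - b)) by (repeat apply Rmin_pos; lra).
  pose proof (Rmin_l (Rmin da db) (1 - b)). pose proof (Rmin_r (Rmin da db) (1 - b)).
  pose proof (Rmin_l da db). pose proof (Rmin_r da db).
  assert (he : 0 < e) by (unfold e; lra).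
  assert (hea : e < da) by (unfold e; lra). assert (heb : e < db) by (unfold e; lra).
  assert (heb1 : b + e < 1) by (unfold e; lra). clearbody e.
  pose proof (bump_average h a e eta hc ha he ltac:(lra)
    (fun x hx hxa => Rlt_le _ _ (Ha x hx (Rle_lt_trans _ _ _ hxa hea)))) as A.
  pose proof (bump_average h b e eta hc ltac:(lra) he heb1
    (fun x hx hxb => Rlt_le _ _ (Hb x hx (Rle_lt_trans _ _ _ hxb heb)))) as B.
  pose proof (hP _ (plateau_test a b e ha hab he heb1)) as Q.
  assert (hBa := cont1_bump_affine a e (Rgt_not_eq _ _ he)).
  assert (hBb := cont1_bump_affine b e (Rgt_not_eq _ _ he)).
  assert (Q' : J (fun x => bumpn 0 ((x - a) / e) * h x) = J (fun x => bumpn 0 ((x - b) / e) * h x)).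
  { rewrite (J_ext _ (fun x => / e * (bumpn 0 ((x - a) / e) * h x - bumpn 0 ((x - b) / e) * h x))) in Q
      by (intros; simpl; ring).
    rewrite J_scal, J_minus in Q by (try apply cont1_minus; apply cont1_mult; assumption).
    apply Rmult_integral in Q. assert (0 < / e) by now apply Rinv_0_lt_compat. lra. }
  rewrite Q' in A. pose proof step1_pos.
  assert (hs : 0 < e * step 1) by nra.
  set (v := J _) in *. set (S := e * step 1) in *.
  assert (hfin : Rabs (h a - h b) * S <= 2 * eta * S).
  { rewrite <- (Rabs_pos_eq S) at 1 by lra. rewrite <- Rabs_mult.
    replace ((h a - h b) * S) with ((v - h b * S) - (v - h a * S)) by ring.
    eapply Rle_trans; [apply Rabs_triang|]. rewrite Rabs_Ropp. lra. }
  apply Rmult_le_reg_r in hfin; [|exact hs]. unfold eta in *. lra.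
Qed.

(** [P] times [prim g] vanishes at both ends. Integration by parts therefore turns the hypothesis
    into [P'] tested against [p + prim g], which du Bois-Reymond makes constant on (0,1). *)
Lemma weak_derivative p g : cont1 p -> cont1 g ->
  (forall P, test_fun P -> J (fun x => - P 1%nat x * p x + P O x * g x) = 0) ->
  forall x, I01 x -> dI p (- g x) x.
Proof.
  intros hp hg hw.
  assert (hG : cont1 (prim g)) by (apply dI_cont1 with g; intros; now apply dI_prim).
  set (h := fun x => p x + prim g x).
  assert (hh : cont1 h) by now apply cont1_plus.
  assert (hconst : forall a b, 0 < a -> a < b -> b < 1 -> h a = h b).
  { apply duBoisReymond; [exact hh|]. intros P hP. pose proof (hw P hP) as H.
    assert (hc : forall n, cont1 (P n)) by (intros n; now apply test_fun_cont1).
    destruct hP as [hd [a [b [ha [hab [hb hsupp]]]]]].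
    assert (F : J (fun x => P 1%nat x * prim g x + P O x * g x) = 0).
    { rewrite (J_FTC (fun x => P O x * prim g x)).
      - rewrite !hsupp by lra. ring.
      - apply cont1_plus; now apply cont1_mult.
      - intros x hx. apply dI_mult; [apply dI_of_is_derive, is_derive_Reals, hd|now apply dI_prim]. }
    rewrite (J_ext _ (fun x => (P 1%nat x * prim g x + P O x * g x)
      - (- P 1%nat x * p x + P O x * g x))) by (intros; unfold h; ring).
    rewrite J_minus, F, H; [ring| |].
    - apply cont1_plus; now apply cont1_mult.
    - apply cont1_plus; apply cont1_mult; auto. now apply (cont1_opp (P 1%nat)). }
  (* Continuity carries the constant to the end points, by comparison with an interior point close
     to [x]. *)
  assert (hall : forall x, I01 x -> h x = h (1/2)).
  { assert (hin : forall y, 0 < y < 1 -> h y = h (1/2)).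
    { intros y hy. destruct (Rtotal_order y (1/2)) as [hlt|[->|hgt]]; [|reflexivity|].
      - apply hconst; lra.
      - symmetry. apply hconst; lra. }
    intros x hx. apply Rminus_diag_uniq.
    destruct (Req_dec (h x - h (1/2)) 0) as [|hne]; [assumption|exfalso].
    destruct (cont1_eps h x hh hx) with (eps := Rabs (h x - h (1/2))) as [d [hd H]];
      [now apply Rabs_pos_lt|].
    unfold I01 in hx.
    pose proof (Rmin_l d (1/2)). pose proof (Rmin_r d (1/2)).
    assert (0 < Rmin d (1/2)) by (apply Rmin_pos; lra).
    destruct (Rle_dec x (1/2)) as [hl|hl].
    - specialize (H (x + Rmin d (1/2) / 2)).
      rewrite (hin (x + Rmin d (1/2) / 2)) in H by lra.
      rewrite (Rabs_minus_sym (h (1/2))) in H.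
      apply (Rlt_irrefl (Rabs (h x - h (1/2)))), H; [unfold I01; lra|].
      replace (x + Rmin d (1/2) / 2 - x) with (Rmin d (1/2) / 2) by ring.
      rewrite Rabs_pos_eq; lra.
    - specialize (H (x - Rmin d (1/2) / 2)).
      rewrite (hin (x - Rmin d (1/2) / 2)) in H by lra.
      rewrite (Rabs_minus_sym (h (1/2))) in H.
      apply (Rlt_irrefl (Rabs (h x - h (1/2)))), H; [unfold I01; lra|].
      replace (x - Rmin d (1/2) / 2 - x) with (- (Rmin d (1/2) / 2)) by ring.
      rewrite Rabs_Ropp, Rabs_pos_eq; lra. }
  intros x hx.
  apply (dI_ext_near (fun y => h (1/2) - prim g y) p _ x 1); [lra|exact hx| |].
  - intros y hy _. rewrite <- (hall y hy). unfold h. ring.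
  - replace (- g x) with (0 - g x) by ring. apply dI_minus; [apply dI_const|now apply dI_prim].
Qed.

(** * The chain of derivatives of the solution *)

(** Partitions with the single cell [[x,y]] suffice: they give Hoelder continuity of exponent 1/2.
    The empty partition shows [0 <= M]. *)
Lemma H1_hoelder v : H1 v -> exists M, 0 <= M /\
  forall x y, I01 x -> I01 y -> Cnorm2 (Csub (v y) (v x)) <= M * Rabs (y - x).
Proof.
  intros [M hM].
  assert (h0 : 0 <= M) by (apply (hM nil); split; [exact I|constructor]).
  exists M. split; [exact h0|].
  assert (lt : forall x y, I01 x -> I01 y -> x < y -> Cnorm2 (Csub (v y) (v x)) <= M * (y - x)).
  { intros x y hx hy hxy.
    assert (h := hM (x :: y :: nil)). simpl in h. rewrite Rplus_0_r in h.
    apply Rle_div_l; [lra|]. apply h. split; [simpl; auto|].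
    apply Forall_cons; [exact hx|]. apply Forall_cons; [exact hy|]. apply Forall_nil. }
  intros x y hx hy. destruct (Rtotal_order x y) as [h|[->|h]].
  - rewrite Rabs_pos_eq by lra. now apply lt.
  - unfold Cnorm2, Csub; simpl. rewrite !Rminus_diag, Rabs_R0. lra.
  - rewrite Rabs_minus_sym, Rabs_pos_eq by lra.
    replace (Cnorm2 (Csub (v y) (v x))) with (Cnorm2 (Csub (v x) (v y)))
      by (unfold Cnorm2, Csub; simpl; ring).
    now apply lt.
Qed.

Lemma H1_contI v : H1 v -> contI v.
Proof.
  intros h. destruct (H1_hoelder v h) as [M [hM H]].
  assert (key : forall x, I01 x -> forall eps, 0 < eps -> exists del, 0 < del /\
    forall y, I01 y -> Rabs (y - x) < del -> Cabs (Csub (v y) (v x)) < eps).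
  { intros x hx eps he. exists (eps ^ 2 / (M + 1)).
    assert (he2 : 0 < eps ^ 2) by now apply pow_lt.
    split; [apply Rdiv_lt_0_compat; lra|]. intros y hy hyx.
    apply Rlt_div_r in hyx; [|lra].
    pose proof (H x y hx hy). pose proof (Rabs_pos (y - x)).
    rewrite <- (sqrt_pow2 eps) by lra. apply sqrt_lt_1_alt.
    split; [apply Cnorm2_ge0|nra]. }
  split; apply cont1_of_eps; intros x hx eps he; destruct (key x hx eps he) as [d [hd K]];
    exists d; (split; [exact hd|]); intros y hy hyx; (eapply Rle_lt_trans; [|apply (K y hy hyx)]).
  - apply (Re_le_Cabs (Csub (v y) (v x))).
  - apply (Im_le_Cabs (Csub (v y) (v x))).
Qed.

(** Test functions are real, so real and imaginary parts separate; each is an instance of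
    [weak_derivative] with [p = x^2 u'] and [g = s u' - W u - f]. *)
Lemma weak_Ls_strong s W u up f : contI W -> contI u -> contI up -> contI f ->
  weak_Ls s W u up f ->
  forall x, I01 x -> has_deriv01 (fun y => Cscal (y ^ 2) (up y))
    (Csub (Cadd (f x) (Cmul (W x) (u x))) (Cmul s (up x))) x.
Proof.
  intros hW hu hup hf hw.
  set (g := fun x => Csub (Csub (Cmul s (up x)) (Cmul (W x) (u x))) (f x)).
  assert (hg : contI g).
  { unfold g. apply contI_sub; [apply contI_sub; apply contI_mul|]; auto. apply contI_const. }
  assert (hsq : cont1 (fun x => x ^ 2)) by apply cont1_pow, cont1_id.
  assert (hcont : forall P, test_fun P -> contI (fun x =>
    Cadd (Cscal (- (x ^ 2 * P 1%nat x)) (up x)) (Cscal (P O x) (g x)))).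
  { intros P hP. pose proof (test_fun_cont1 P 0 hP). pose proof (test_fun_cont1 P 1 hP).
    apply contI_add; apply contI_scal; auto.
    apply (cont1_opp (fun x => x ^ 2 * P 1%nat x)). now apply cont1_mult. }
  intros x hx. apply has_deriv01_dI. split.
  - replace (Re _) with (- Re (g x)) by (unfold g; simpl; ring).
    apply (weak_derivative (fun y => y ^ 2 * Re (up y)) (fun y => Re (g y)));
      [apply cont1_mult; [exact hsq|apply hup]|apply hg| |exact hx].
    intros P hP. pose proof (f_equal Re (hw P hP)) as E. simpl Re in E.
    pose proof (J_Rint _ (proj1 (hcont P hP))) as E'. simpl in E, E'. rewrite E in E'.
    rewrite E'. apply J_ext. intros y _. simpl. ring.
  - replace (Im _) with (- Im (g x)) by (unfold g; simpl; ring).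
    apply (weak_derivative (fun y => y ^ 2 * Im (up y)) (fun y => Im (g y)));
      [apply cont1_mult; [exact hsq|apply hup]|apply hg| |exact hx].
    intros P hP. pose proof (f_equal Im (hw P hP)) as E. simpl Im in E.
    pose proof (J_Rint _ (proj2 (hcont P hP))) as E'. simpl in E, E'. rewrite E in E'.
    rewrite E'. apply J_ext. intros y _. simpl. ring.
Qed.

(* [leib W D n i j] is the n-th derivative of [W_i D_j] when [W] and [D] are derivative chains. *)
Fixpoint leib (W D : nat -> R -> Cx) (n i j : nat) (x : R) : Cx :=
  match n with
  | O => Cmul (W i x) (D j x)
  | S n => Cadd (leib W D n (S i) j x) (leib W D n i (S j) x)
  end.

Lemma leib_ext W D D' n i j x : (forall k, (k <= n + j)%nat -> D k x = D' k x) ->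
  leib W D n i j x = leib W D' n i j x.
Proof.
  revert i j. induction n as [|n IH]; intros i j h; simpl.
  - rewrite h; [reflexivity|lia].
  - rewrite !IH; [reflexivity| |]; intros; apply h; lia.
Qed.

Lemma leib_zero W D n i j x : (forall k, D k x = C0) -> leib W D n i j x = C0.
Proof.
  intros h. revert i j. induction n as [|n IH]; intros i j; simpl.
  - rewrite h. apply Cx_eq; simpl; ring.
  - rewrite !IH. apply Cx_eq; simpl; ring.
Qed.

Lemma leib_deriv W D n i j x :
  (forall k, has_deriv01 (W k) (W (S k) x) x) ->
  (forall k, (k <= n + j)%nat -> has_deriv01 (D k) (D (S k) x) x) ->
  has_deriv01 (leib W D n i j) (leib W D (S n) i j x) x.
Proof.
  intros hW. revert i j. induction n as [|n IH]; intros i j hD.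
  - simpl. apply has_deriv01_mul; [apply hW|apply hD; lia].
  - change (leib W D (S (S n)) i j x) with
      (Cadd (leib W D (S n) (S i) j x) (leib W D (S n) i (S j) x)).
    apply (has_deriv01_add (leib W D n (S i) j) (leib W D n i (S j)));
      apply IH; intros; apply hD; lia.
Qed.

(* The equation L_s u = f differentiated n times reads [x^2 D_(n+2) = rhs n]. *)
Definition rhs (s : Cx) (F W D : nat -> R -> Cx) (n : nat) (x : R) : Cx :=
  Csub (Csub (Cadd (F n x) (leib W D n 0 0 x))
             (Cmul (mkCx (2 * INR (S n) * x + Re s) (Im s)) (D (S n) x)))
       (Cscal (INR n * INR (S n)) (D n x)).

Lemma rhs_ext s F W D D' n x : (forall k, (k <= S n)%nat -> D k x = D' k x) ->
  rhs s F W D n x = rhs s F W D' n x.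
Proof.
  intros h. unfold rhs. rewrite (leib_ext W D D'), !h; auto. intros; apply h; lia.
Qed.

(* [hist n k] is D_k for k <= n+1; the whole history is carried because [rhs n] involves all of it. *)
Fixpoint hist (delta : R) (s : Cx) (F W : nat -> R -> Cx) (u up : R -> Cx) (n : nat)
  : nat -> R -> Cx :=
  match n with
  | O => fun k => match k with O => u | S _ => up end
  | S n => fun k =>
      if (k <=? S n)%nat then hist delta s F W u up n k
      else fun x => if Rlt_dec x delta then C0
                    else Cscal (/ x ^ 2) (rhs s F W (hist delta s F W u up n) n x)
  end.

Definition uchain (delta : R) (s : Cx) (F W : nat -> R -> Cx) (u up : R -> Cx) (k : nat) : R -> Cx :=
  hist delta s F W u up k k.

(** A stage never alters the entries it inherits, so any stage that has reached index [k] may stand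
    for the diagonal [uchain]. *)
Lemma hist_uchain delta s F W u up n k : (k <= S n)%nat ->
  hist delta s F W u up n k = uchain delta s F W u up k.
Proof.
  assert (step : forall m k, (k <= S m)%nat ->
    hist delta s F W u up (S m) k = hist delta s F W u up m k).
  { intros m j hj. simpl hist at 1. apply Nat.leb_le in hj. now rewrite hj. }
  intros hk. unfold uchain. destruct (Nat.eq_dec k (S n)) as [->|hne].
  - symmetry. apply step. lia.
  - assert (hle : (k <= n)%nat) by lia. clear hk hne.
    induction hle as [|m hle IH]; [reflexivity|]. rewrite step by lia. exact IH.
Qed.

Lemma uchain_SS delta s F W u up n x :
  uchain delta s F W u up (S (S n)) x =
  if Rlt_dec x delta then C0 else Cscal (/ x ^ 2) (rhs s F W (uchain delta s F W u up) n x).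
Proof.
  rewrite <- (hist_uchain delta s F W u up (S n)) by lia.
  simpl hist. replace (match n with O => false | S m' => (n <=? m')%nat end) with false.
  - destruct (Rlt_dec x delta); [reflexivity|]. f_equal. apply rhs_ext.
    intros k hk. now rewrite hist_uchain.
  - destruct n as [|n]; [reflexivity|]. symmetry. apply Nat.leb_gt. lia.
Qed.

Lemma is_derive_inv_sq x : x <> 0 -> is_derive (fun y => / y ^ 2) x (- 2 / x ^ 3).
Proof.
  intros hx. auto_derive; [|field; auto]. simpl. rewrite Rmult_1_r.
  now apply Rmult_integral_contrapositive_currified.
Qed.

(** The derivative of [x^2 D_(n+2)] is [x^2 D_(n+3) + 2x D_(n+2)]. Moving the surplus [2x D_(n+2)]
    to the right raises the first-order coefficient from [2(n+1)x] to [2(n+2)x]; differentiating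
    that coefficient raises [n(n+1)] to [(n+1)(n+2)]. *)
Lemma rhs_deriv s F W D n x :
  has_deriv01 (F n) (F (S n) x) x ->
  (forall k, has_deriv01 (W k) (W (S k) x) x) ->
  (forall k, (k <= S n)%nat -> has_deriv01 (D k) (D (S k) x) x) ->
  has_deriv01 (rhs s F W D n)
    (Cadd (rhs s F W D (S n) x) (Cscal (2 * x) (D (S (S n)) x))) x.
Proof.
  intros hF hW hD.
  assert (hlin : has_deriv01 (fun y => mkCx (2 * INR (S n) * y + Re s) (Im s))
                             (mkCx (2 * INR (S n)) 0) x).
  { apply has_deriv01_dI. simpl Re; simpl Im. split; [|apply dI_const].
    apply dI_of_is_derive. auto_derive; [trivial|ring]. }
  assert (h := has_deriv01_sub _ _ _ _ _
    (has_deriv01_sub _ _ _ _ _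
       (has_deriv01_add _ _ _ _ _ hF (leib_deriv W D n 0 0 x hW (fun k hk => hD k ltac:(lia))))
       (has_deriv01_mul _ _ _ _ _ hlin (hD (S n) ltac:(lia))))
    (has_deriv01_scal _ _ _ _ _ (dI_const (INR n * INR (S n)) x) (hD n ltac:(lia)))).
  cbv beta in h. match type of h with has_deriv01 _ ?v _ =>
    replace (Cadd (rhs s F W D (S n) x) (Cscal (2 * x) (D (S (S n)) x))) with v end; [exact h|].
  unfold rhs. apply Cx_eq; cbn -[leib INR]; rewrite !S_INR; ring.
Qed.

Lemma uchain_zero delta s F W u up :
  (forall x, I01 x -> x < delta -> u x = C0) ->
  (forall x, I01 x -> x < delta -> up x = C0) ->
  forall n x, I01 x -> x < delta -> uchain delta s F W u up n x = C0.
Proof.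
  intros h0 h1 [|[|n]] x hx hxd; [now apply h0|now apply h1|].
  rewrite uchain_SS. destruct (Rlt_dec x delta); [reflexivity|lra].
Qed.

(** Left of [delta] both sides vanish, because [F] does too; elsewhere the division by [x^2] is
    undone. Unlike the definition, this form has no case distinction and can be used across
    [delta]. *)
Lemma uchain_eq delta s F W u up : 0 < delta ->
  (forall x, I01 x -> x < delta -> u x = C0) ->
  (forall x, I01 x -> x < delta -> up x = C0) ->
  (forall n x, I01 x -> x < delta -> F n x = C0) ->
  forall n x, I01 x ->
    Cscal (x ^ 2) (uchain delta s F W u up (S (S n)) x)
    = rhs s F W (uchain delta s F W u up) n x.
Proof.
  intros hd h0 h1 hF n x hx.
  assert (hz := uchain_zero delta s F W u up h0 h1).
  destruct (Rlt_dec x delta) as [hlt|hge].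
  - unfold rhs. rewrite leib_zero by (intros k; now apply hz).
    rewrite !hz, hF by assumption. apply Cx_eq; simpl; ring.
  - rewrite uchain_SS. destruct (Rlt_dec x delta); [lra|].
    apply Cx_eq; cbn -[rhs pow]; field; lra.
Qed.

Lemma uchain_deriv delta s F W u up : 0 < delta ->
  (forall x, I01 x -> x < delta -> u x = C0) ->
  (forall x, I01 x -> x < delta -> up x = C0) ->
  (forall n x, I01 x -> x < delta -> F n x = C0) ->
  (forall n x, I01 x -> has_deriv01 (F n) (F (S n) x) x) ->
  (forall n x, I01 x -> has_deriv01 (W n) (W (S n) x) x) ->
  (forall x, I01 x -> has_deriv01 u (up x) x) ->
  (forall x, I01 x -> has_deriv01 up (uchain delta s F W u up 2 x) x) ->
  forall n x, I01 x ->
    has_deriv01 (uchain delta s F W u up n) (uchain delta s F W u up (S n) x) x.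
Proof.
  intros hd h0 h1 hF0 hF hW hu hup.
  assert (hz := uchain_zero delta s F W u up h0 h1).
  assert (heq := uchain_eq delta s F W u up hd h0 h1 hF0).
  set (D := uchain delta s F W u up) in *.
  (* All lower orders are carried along, since differentiating [rhs n] differentiates a whole
     Leibniz sum. *)
  assert (H : forall n k, (k <= n)%nat -> forall x, I01 x -> has_deriv01 (D k) (D (S k) x) x);
    [|intros n; now apply (H n)].
  induction n as [|n IH]; intros k hk x hx.
  { replace k with O by lia. now apply hu. }
  destruct (Nat.eq_dec k (S n)) as [->|hne]; [|apply IH; [lia|exact hx]].
  destruct n as [|n]; [now apply hup|].
  destruct (Rlt_dec x delta) as [hlt|hge].
  - rewrite (hz (S (S (S n)))) by assumption.
    apply (has_deriv01_ext_near (fun _ => C0) _ _ x (delta - x)); [lra|exact hx| |apply has_deriv01_const].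
    intros y hy hyx. symmetry. apply hz; [exact hy|]. apply Rabs_def2 in hyx. lra.
  - assert (hx0 : 0 < x) by lra.
    (* By [heq] the quotient formula holds on both sides of [delta], so the neighbourhood only has
       to avoid 0: radius [x]. *)
    apply (has_deriv01_ext_near (fun y => Cscal (/ y ^ 2) (rhs s F W D n y)) _ _ x x); [lra|exact hx| |].
    + intros y hy hyx. apply Rabs_def2 in hyx. rewrite <- heq by exact hy.
      apply Cx_eq; cbn -[pow]; field; lra.
    + assert (h := has_deriv01_scal _ _ _ _ _
        (dI_of_is_derive _ _ _ (is_derive_inv_sq x ltac:(lra)))
        (rhs_deriv s F W D n x (hF n x hx) (fun k => hW k x hx) (fun k hk => IH k hk x hx))).
      rewrite <- !heq in h by exact hx.
      match type of h with has_deriv01 _ ?v _ => replace (D (S (S (S n))) x) with v end; [exact h|].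
      apply Cx_eq; cbn -[pow]; field; lra.
Qed.

Lemma up_deriv delta s F W u up : 0 < delta ->
  (forall x, I01 x -> x < delta -> up x = C0) ->
  (forall x, I01 x -> has_deriv01 (fun y => Cscal (y ^ 2) (up y))
    (Csub (Cadd (F O x) (Cmul (W O x) (u x))) (Cmul s (up x))) x) ->
  forall x, I01 x -> has_deriv01 up (uchain delta s F W u up 2 x) x.
Proof.
  intros hd h1 hst x hx. rewrite uchain_SS. destruct (Rlt_dec x delta) as [hlt|hge].
  - apply (has_deriv01_ext_near (fun _ => C0) _ _ x (delta - x)); [lra|exact hx| |apply has_deriv01_const].
    intros y hy hyx. symmetry. apply h1; [exact hy|]. apply Rabs_def2 in hyx. lra.
  - assert (hx0 : 0 < x) by lra.
    apply (has_deriv01_ext_near (fun y => Cscal (/ y ^ 2) (Cscal (y ^ 2) (up y))) _ _ x x);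
      [lra|exact hx| |].
    + intros y hy hyx. apply Rabs_def2 in hyx. apply Cx_eq; cbn -[pow]; field; lra.
    + assert (h := has_deriv01_scal _ _ _ _ _
        (dI_of_is_derive _ _ _ (is_derive_inv_sq x ltac:(lra))) (hst x hx)).
      match type of h with has_deriv01 _ ?v _ => match goal with |- has_deriv01 _ ?w _ =>
        replace w with v end end; [exact h|].
      unfold rhs. change (uchain delta s F W u up 1 x) with (up x).
      simpl leib. change (uchain delta s F W u up 0 x) with (u x).
      apply Cx_eq; cbn -[pow INR]; simpl INR; field; lra.
Qed.

(** * Energy and Gevrey estimates *)

(* Pairing the equation with the conjugate of u and integrating by parts. *)
Lemma energy_estimate delta s K W u up f : 0 < delta -> 0 <= K ->
  contI W -> (forall x, 0 < x < 1 -> Cabs (W x) <= K) -> contI f -> contI up ->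
  (forall x, I01 x -> x < delta -> up x = C0) -> u 0 = C0 -> u 1 = C0 ->
  (forall x, I01 x -> has_deriv01 u (up x) x) ->
  (forall x, I01 x -> has_deriv01 (fun y => Cscal (y ^ 2) (up y))
    (Csub (Cadd (f x) (Cmul (W x) (u x))) (Cmul s (up x))) x) ->
  delta ^ 2 / 2 * J (fun x => Cnorm2 (up x)) <=
  1 / 2 * J (fun x => Cnorm2 (f x))
    + (1 / 2 + K + Cnorm2 s / (2 * delta ^ 2)) * J (fun x => Cnorm2 (u x)).
Proof.
  intros hd hK hW hWK hf hup h1 hu0 hu1 hu hst.
  assert (hcu : contI u) by now apply has_deriv01_contI with up.
  set (q := fun x => Csub (Cadd (f x) (Cmul (W x) (u x))) (Cmul s (up x))) in *.
  assert (hq : contI q).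
  { unfold q. apply contI_sub; [apply contI_add; [exact hf|now apply contI_mul]|].
    apply contI_mul; [apply contI_const|exact hup]. }
  set (c := 1 / 2 + K + Cnorm2 s / (2 * delta ^ 2)).
  set (e := fun x => (Re (q x) * Re (u x) + x ^ 2 * Re (up x) * Re (up x))
                     + (Im (q x) * Im (u x) + x ^ 2 * Im (up x) * Im (up x))).
  assert (hsq : cont1 (fun x => x ^ 2)) by apply cont1_pow, cont1_id.
  assert (he : cont1 e).
  { destruct hq, hcu, hup. unfold e.
    repeat first [exact hsq | assumption | apply cont1_plus | apply cont1_mult]. }
  assert (Je : J e = 0).
  { rewrite (J_FTC (fun x => x ^ 2 * Re (up x) * Re (u x) + x ^ 2 * Im (up x) * Im (u x))).
    - rewrite hu0, hu1. simpl. ring.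
    - exact he.
    - intros x hx. destruct (proj1 (has_deriv01_dI _ _ _) (hst x hx)) as [a b].
      destruct (proj1 (has_deriv01_dI _ _ _) (hu x hx)) as [a' b'].
      apply dI_plus.
      + exact (dI_mult _ _ _ _ _ a a').
      + exact (dI_mult _ _ _ _ _ b b'). }
  assert (cf := cont1_Cnorm2 f hf). assert (cu := cont1_Cnorm2 u hcu).
  assert (cup := cont1_Cnorm2 up hup).
  assert (cs : forall k g, cont1 g -> cont1 (fun x => k * g x))
    by (intros k g hg; apply (cont1_mult (fun _ => k)); [apply cont1_const|exact hg]).
  assert (H : J (fun x => delta ^ 2 / 2 * Cnorm2 (up x)) <=
              J (fun x => e x + (1 / 2 * Cnorm2 (f x) + c * Cnorm2 (u x)))).
  { apply J_le; [now apply cs| |].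
    - apply cont1_plus; [exact he|]. apply cont1_plus; now apply cs.
    - intros x hx.
      assert (hx1 : I01 x) by (unfold I01; lra).
      (* Coercivity: the support of [u'] lets [delta^2] replace the degenerate weight [x^2]. *)
      assert (P1 : delta ^ 2 * Cnorm2 (up x) <= x ^ 2 * Cnorm2 (up x)).
      { destruct (Rlt_dec x delta) as [hlt|hge].
        - rewrite h1 by assumption. unfold Cnorm2; simpl. lra.
        - apply Rmult_le_compat_r; [apply Cnorm2_ge0|]. apply pow_incr. lra. }
      assert (P2 : 0 <= (K + Re (W x)) * Cnorm2 (u x)).
      { apply Rmult_le_pos; [|apply Cnorm2_ge0].
        pose proof (Re_le_Cabs (W x)). specialize (hWK x hx).
        pose proof (Rabs_maj2 (Re (W x))). lra. }
      (* Young's inequality for [Re(s u' conj u)], weighted to spend only half of [delta^2 |u'|^2];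
         the defect is half a sum of two squares. *)
      assert (P3 : (Re s * Re (up x) - Im s * Im (up x)) * Re (u x)
                   + (Re s * Im (up x) + Im s * Re (up x)) * Im (u x)
                   <= delta ^ 2 / 2 * Cnorm2 (up x) + Cnorm2 s / (2 * delta ^ 2) * Cnorm2 (u x)).
      { set (A := Re s * Re (u x) + Im s * Im (u x)).
        set (B := Re s * Im (u x) - Im s * Re (u x)).
        assert (E : delta ^ 2 / 2 * Cnorm2 (up x) + Cnorm2 s / (2 * delta ^ 2) * Cnorm2 (u x)
          - ((Re s * Re (up x) - Im s * Im (up x)) * Re (u x)
                   + (Re s * Im (up x) + Im s * Re (up x)) * Im (u x))
          = / 2 * ((delta * Re (up x) - A / delta) ^ 2 + (delta * Im (up x) - B / delta) ^ 2)).
        { unfold A, B, Cnorm2. field. lra. }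
        pose proof (pow2_ge_0 (delta * Re (up x) - A / delta)).
        pose proof (pow2_ge_0 (delta * Im (up x) - B / delta)). lra. }
      assert (P4 : 0 <= (Re (f x) + Re (u x)) ^ 2 + (Im (f x) + Im (u x)) ^ 2).
      { pose proof (pow2_ge_0 (Re (f x) + Re (u x))).
        pose proof (pow2_ge_0 (Im (f x) + Im (u x))). lra. }
      unfold e, q, c. cbn [Re Im Csub Cadd Cmul].
      set (r := Cnorm2 s / (2 * delta ^ 2)) in *. unfold Cnorm2 in *.
      ring_simplify in P1. ring_simplify in P2. ring_simplify in P3. ring_simplify in P4.
      ring_simplify. lra. }
  rewrite J_plus, J_plus, !J_scal, Je in H; auto; [lra|].
  apply cont1_plus; now apply cs.
Qed.

(** * Weights, the Leibniz sum and the recursive L^2 bound *)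

Definition alpha (sig : R) (j : nat) : R := (/ sig) ^ j * (INR (fact j) / (INR j + 1)) ^ 2.
(** The reciprocal square root of [wt] (see [wt_nu]): the size that a finite Y-norm allows for
    [f^(n)]. *)
Definition nu (sig : R) (n : nat) : R := (/ sig) ^ n * (INR (fact n) * INR (fact (S n))).

Lemma alpha_pos sig j : 0 < sig -> 0 < alpha sig j.
Proof.
  intros hs. pose proof (INR_fact_lt_0 j). pose proof (pos_INR j).
  apply Rmult_lt_0_compat; apply pow_lt; [now apply Rinv_0_lt_compat|].
  apply Rdiv_lt_0_compat; lra.
Qed.

Lemma nu_pos sig n : 0 < sig -> 0 < nu sig n.
Proof.
  intros hs. apply Rmult_lt_0_compat; [apply pow_lt; now apply Rinv_0_lt_compat|].
  apply Rmult_lt_0_compat; apply INR_fact_lt_0.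
Qed.

(* A majorant of the sum over k of binom(n,k) (i+k)!^2 ((j+n-k)!/(j+n-k+1))^2. *)
Definition phi (n i j : nat) : R :=
  INR (fact i) ^ 2 * (INR (fact j) / (INR j + 1)) ^ 2 *
  (INR (fact (i + j + n)) / INR (fact (i + j))) *
  (INR (fact (S (i + j + n))) / INR (fact (S (i + j)))).

Lemma fact_S n : INR (fact (S n)) = (INR n + 1) * INR (fact n).
Proof. rewrite fact_simpl, mult_INR, S_INR. reflexivity. Qed.

(** The recursion of [leib] at the level of bounds. With common factors cleared it reads [(i+1)^2 +
    (j+1)^4/(j+2)^2 <= (i+j+1)(i+j+2)]. Expanding the right side in powers of [i+1] leaves at least
    [j^2+3j+1] beyond [(i+1)^2], and this is at least [(j+1)^2]. *)
Lemma phi_step n i j : phi n (S i) j + phi n i (S j) <= phi (S n) i j.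
Proof.
  unfold phi.
  replace (S i + j)%nat with (S (i + j)) by lia. replace (i + S j)%nat with (S (i + j)) by lia.
  replace (i + j + S n)%nat with (S (i + j + n)) by lia.
  replace (S (i + j) + n)%nat with (S (i + j + n)) by lia.
  set (A := INR (fact (S (i + j + n)))). set (B := INR (fact (S (S (i + j + n))))).
  rewrite (fact_S (S (i + j))), (fact_S (i + j)), (fact_S i), (fact_S j), !S_INR, plus_INR.
  pose proof (pos_INR i) as hi. pose proof (pos_INR j) as hj.
  pose proof (INR_fact_lt_0 (i + j)) as hG. pose proof (INR_fact_lt_0 j) as hf.
  set (I := INR i) in *. set (Jn := INR j) in *. set (G := INR (fact (i + j))) in *.
  set (fi := INR (fact i)). set (fj := INR (fact j)) in *.
  assert (hAB : 0 <= A * B) by (apply Rmult_le_pos; apply pos_INR).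
  assert (key : (I + 1) ^ 2 * (Jn + 2) ^ 2 + (Jn + 1) ^ 4
                <= (I + Jn + 1) * (I + Jn + 2) * (Jn + 2) ^ 2).
  { assert (0 <= I * Jn) by nra. assert (0 <= I * Jn * Jn) by nra.
    assert (0 <= I * Jn * Jn * Jn) by nra. assert (0 <= Jn * Jn) by nra.
    assert (0 <= Jn * Jn * Jn) by nra. lra || nra. }
  assert (E : fi ^ 2 * (fj / (Jn + 1)) ^ 2 * (A / G) * (B / ((I + Jn + 1) * G))
    - (((I + 1) * fi) ^ 2 * (fj / (Jn + 1)) ^ 2 * (A / ((I + Jn + 1) * G)) *
         (B / ((I + Jn + 1 + 1) * ((I + Jn + 1) * G)))
       + fi ^ 2 * ((Jn + 1) * fj / (Jn + 1 + 1)) ^ 2 * (A / ((I + Jn + 1) * G)) *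
         (B / ((I + Jn + 1 + 1) * ((I + Jn + 1) * G))))
    = ((I + Jn + 1) * (I + Jn + 2) * (Jn + 2) ^ 2 - ((I + 1) ^ 2 * (Jn + 2) ^ 2 + (Jn + 1) ^ 4))
      * (fi ^ 2 * fj ^ 2 * (A * B)
         * / ((Jn + 1) ^ 2 * (Jn + 2) ^ 2 * (I + Jn + 1) ^ 2 * (I + Jn + 2) * G ^ 2))).
  { field. repeat split; lra. }
  match type of E with _ = ?r => assert (0 <= r) end; [|lra].
  apply Rmult_le_pos; [lra|]. apply Rmult_le_pos.
  - apply Rmult_le_pos; [|exact hAB]. apply Rmult_le_pos; apply pow2_ge_0.
  - left. apply Rinv_0_lt_compat. repeat apply Rmult_lt_0_compat; try apply pow_lt; lra.
Qed.

Lemma leib_l2le sig K B W D m : 0 < sig -> 0 <= K -> 0 <= B ->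
  (forall i, contI (W i)) ->
  (forall i x, 0 < x < 1 -> Cabs (W i x) <= K * ((/ sig) ^ i * INR (fact i) ^ 2)) ->
  (forall j, (j <= m)%nat -> l2le (D j) (B * alpha sig j)) ->
  forall n i j, (j + n <= m)%nat ->
    l2le (leib W D n i j) (K * B * ((/ sig) ^ (i + j + n) * phi n i j)).
Proof.
  intros hs hK hB hW hWb hD.
  assert (hsi : 0 < / sig) by now apply Rinv_0_lt_compat.
  induction n as [|n IH]; intros i j hj.
  - apply l2le_mono with (K * ((/ sig) ^ i * INR (fact i) ^ 2) * (B * alpha sig j)).
    + apply (l2le_mul (W i) (D j)); [apply hW| |apply hWb|apply hD; lia].
      apply Rmult_le_pos; [exact hK|]. apply Rmult_le_pos; [apply pow_le; lra|apply pow2_ge_0].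
    + right. unfold phi, alpha. rewrite Nat.add_0_r, pow_add.
      pose proof (INR_fact_lt_0 (i + j)). pose proof (INR_fact_lt_0 (S (i + j))).
      pose proof (pos_INR j). field. repeat split; lra.
  - apply l2le_mono with (K * B * ((/ sig) ^ (S i + j + n) * phi n (S i) j)
                          + K * B * ((/ sig) ^ (i + S j + n) * phi n i (S j))).
    + apply (l2le_add (leib W D n (S i) j) (leib W D n i (S j))); apply IH; lia.
    + replace (S i + j + n)%nat with (i + j + S n)%nat by lia.
      replace (i + S j + n)%nat with (i + j + S n)%nat by lia.
      rewrite <- !Rmult_plus_distr_l.
      apply Rmult_le_compat_l; [now apply Rmult_le_pos|].
      apply Rmult_le_compat_l; [apply pow_le; lra|apply phi_step].
Qed.

(** One summand for each term of [rhs]: [1] for [f^(n)], [K] for the Leibniz sum, the quotient by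
    [sig] for the first-order term, [1] for [n(n+1) u^(n)]. *)
Definition kappa0 (sig K : R) (s : Cx) : R :=
  1 + K + (2 + (Rabs (Re s) + Rabs (Im s))) / sig + 1.

Lemma rhs_l2le sig K B s F W D n : 0 < sig -> 0 <= K -> 0 <= B ->
  (forall i, contI (W i)) ->
  (forall i x, 0 < x < 1 -> Cabs (W i x) <= K * ((/ sig) ^ i * INR (fact i) ^ 2)) ->
  (forall j, (j <= S n)%nat -> l2le (D j) (B * alpha sig j)) ->
  l2le (F n) (B * nu sig n) ->
  l2le (rhs s F W D n) (kappa0 sig K s * B * nu sig n).
Proof.
  intros hs hK hB hW hWb hD hF.
  assert (hsi : 0 < / sig) by now apply Rinv_0_lt_compat.
  set (S0 := Rabs (Re s) + Rabs (Im s)).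
  assert (hS0 : 0 <= S0) by (pose proof (Rabs_pos (Re s)); pose proof (Rabs_pos (Im s)); unfold S0; lra).
  pose proof (pos_INR n) as hn. pose proof (INR_fact_lt_0 n) as hf.
  assert (hsn : 0 < (/ sig) ^ n) by now apply pow_lt.
  assert (h1 := leib_l2le sig K B W D n hs hK hB hW hWb (fun j hj => hD j ltac:(lia)) n 0 0 ltac:(lia)).
  assert (h2 : l2le (fun x => Cmul (mkCx (2 * INR (S n) * x + Re s) (Im s)) (D (S n) x))
                 ((2 * INR (S n) + S0) * (B * alpha sig (S n)))).
  { apply (l2le_mul (fun x => mkCx (2 * INR (S n) * x + Re s) (Im s)) (D (S n))).
    - split; cbn [Re Im]; [|apply cont1_const].
      apply cont1_plus; [|apply cont1_const].
      apply cont1_mult; [apply cont1_const|apply cont1_id].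
    - rewrite S_INR. lra.
    - intros x hx. eapply Rle_trans; [apply Cabs_le_sum|]. cbn [Re Im].
      assert (Rabs (2 * INR (S n) * x + Re s) <= 2 * INR (S n) + Rabs (Re s)); [|unfold S0; lra].
      eapply Rle_trans; [apply Rabs_triang|]. apply Rplus_le_compat_r.
      rewrite S_INR. rewrite Rabs_pos_eq; nra.
    - apply hD; lia. }
  assert (h3 := l2le_scal (INR n * INR (S n)) (D n) _ (hD n ltac:(lia))).
  eapply l2le_mono.
  { apply (l2le_sub (fun x => Csub (Cadd (F n x) (leib W D n 0 0 x))
             (Cmul (mkCx (2 * INR (S n) * x + Re s) (Im s)) (D (S n) x)))); [|exact h3].
    apply (l2le_sub (fun x => Cadd (F n x) (leib W D n 0 0 x))); [|exact h2].
    apply (l2le_add (F n)); [exact hF|exact h1]. }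
  (* [phi n 0 0] is exactly [n! (n+1)!], so the Leibniz sum lands on the scale [nu]. *)
  assert (E1 : (/ sig) ^ (0 + 0 + n) * phi n 0 0 = nu sig n).
  { unfold phi, nu. change (0 + 0 + n)%nat with n.
    change (INR (fact (0 + 0))) with 1. change (INR (fact (S (0 + 0)))) with 1.
    change (INR (fact 0)) with 1. change (INR 0) with 0. field. }
  (* The quotient of [alpha (n+1)] by [nu n] is [(n+1)/(n+2)^2/sig], which absorbs the linear growth
     of the coefficient. *)
  assert (E2 : (2 * INR (S n) + S0) * alpha sig (S n) <= (2 + S0) / sig * nu sig n).
  { unfold alpha, nu. rewrite fact_S, S_INR. simpl pow at 1.
    replace ((2 * (INR n + 1) + S0) * (/ sig * (/ sig) ^ n *
       ((INR n + 1) * INR (fact n) / (INR n + 1 + 1)) ^ 2))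
      with (((2 * (INR n + 1) + S0) * (INR n + 1) / (INR n + 2) ^ 2)
         * (/ sig * ((/ sig) ^ n * (INR (fact n) * ((INR n + 1) * INR (fact n)))))) by (field; lra).
    unfold Rdiv at 2. rewrite (Rmult_assoc (2 + S0)).
    apply Rmult_le_compat_r.
    - repeat apply Rmult_le_pos; lra.
    - apply Rle_div_l; [apply pow_lt; lra|].
      assert (0 <= S0 * INR n) by nra. assert (0 <= S0 * INR n * INR n) by nra. nra. }
  assert (E3 : Rabs (INR n * INR (S n)) * alpha sig n <= nu sig n).
  { unfold alpha, nu. rewrite fact_S, S_INR. rewrite Rabs_pos_eq by nra.
    replace (INR n * (INR n + 1) * ((/ sig) ^ n * (INR (fact n) / (INR n + 1)) ^ 2))
      with (INR n / (INR n + 1) * ((/ sig) ^ n * INR (fact n) ^ 2)) by (field; lra).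
    replace ((/ sig) ^ n * (INR (fact n) * ((INR n + 1) * INR (fact n))))
      with ((INR n + 1) * ((/ sig) ^ n * INR (fact n) ^ 2)) by ring.
    apply Rmult_le_compat_r; [apply Rmult_le_pos; [lra|apply pow2_ge_0]|].
    apply Rle_div_l; [lra|]. nra. }
  rewrite E1. unfold kappa0. fold S0.
  apply Rmult_le_compat_l with (r := B) in E2; [|exact hB].
  apply Rmult_le_compat_l with (r := B) in E3; [|exact hB]. lra.
Qed.

(** Division by [x^2] at the level of norms: where [g] is nonzero, [x^2] is at least [delta^2]. *)
Lemma l2le_weighted delta g A : 0 < delta -> contI g ->
  (forall x, I01 x -> x < delta -> g x = C0) ->
  l2le (fun x => Cscal (x ^ 2) (g x)) A -> l2le g (A / delta ^ 2).
Proof.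
  intros hd hc h0 [_ [hA h]].
  assert (hd2 : 0 < delta ^ 2) by now apply pow_lt.
  split; [exact hc|split; [now apply Rdiv_le_0_compat|]].
  assert (H : J (fun x => (delta ^ 2) ^ 2 * Cnorm2 (g x)) <= J (fun x => Cnorm2 (Cscal (x ^ 2) (g x)))).
  { apply J_le.
    - apply (cont1_mult (fun _ => (delta ^ 2) ^ 2)); [apply cont1_const|now apply cont1_Cnorm2].
    - apply cont1_Cnorm2, contI_scal; [apply cont1_pow, cont1_id|exact hc].
    - intros x hx.
      replace (Cnorm2 (Cscal (x ^ 2) (g x))) with ((x ^ 2) ^ 2 * Cnorm2 (g x))
        by (unfold Cnorm2, Cscal; simpl; ring).
      destruct (Rlt_dec x delta).
      + rewrite h0; [|unfold I01; lra|assumption]. unfold Cnorm2; simpl. lra.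
      + apply Rmult_le_compat_r; [apply Cnorm2_ge0|]. apply pow_incr.
        split; [lra|]. apply pow_incr. lra. }
  rewrite J_scal in H by now apply cont1_Cnorm2.
  replace ((A / delta ^ 2) ^ 2) with (A ^ 2 / (delta ^ 2) ^ 2) by (field; lra).
  apply Rle_div_r; [now apply pow_lt|]. lra.
Qed.

Definition kappa (delta sig K : R) (s : Cx) : R := 9 / 4 * kappa0 sig K s * sig ^ 2 / delta ^ 2.

(** The exact factor is [sig^2 ((n+3)/(n+2))^2 / (n+1)]; the squared fraction is largest at [n = 0],
    whence 9/4. *)
Lemma nu_alpha sig n : 0 < sig ->
  nu sig n <= 9 / 4 * sig ^ 2 / (INR n + 1) * alpha sig (S (S n)).
Proof.
  intros hs. unfold nu, alpha. rewrite !fact_S, !S_INR.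
  pose proof (pos_INR n) as hn. pose proof (INR_fact_lt_0 n) as hf.
  assert (hsn : 0 < (/ sig) ^ n) by (apply pow_lt; now apply Rinv_0_lt_compat).
  replace ((/ sig) ^ S (S n)) with ((/ sig) ^ n * / sig ^ 2) by (simpl; field; lra).
  replace (9 / 4 * sig ^ 2 / (INR n + 1) * ((/ sig) ^ n * / sig ^ 2 *
     ((INR n + 1 + 1) * ((INR n + 1) * INR (fact n)) / (INR n + 1 + 1 + 1)) ^ 2))
    with ((/ sig) ^ n * (INR (fact n) * ((INR n + 1) * INR (fact n)))
          * (9 / 4 * (INR n + 2) ^ 2 / (INR n + 3) ^ 2)) by (field; lra).
  rewrite <- (Rmult_1_r (_ * _)) at 1.
  apply Rmult_le_compat_l; [repeat apply Rmult_le_pos; lra|].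
  apply Rle_div_r; [apply pow_lt; lra|]. nra.
Qed.

(* The factor kappa/(n+1) exceeds 1 only for finitely many n, so the losses multiply up to (1+kappa)^N. *)
Lemma l2le_chain_bound sig k N B D : 0 < sig -> 0 <= k -> k <= INR N -> 0 <= B ->
  l2le (D O) (B * alpha sig 0) -> l2le (D 1%nat) (B * alpha sig 1) ->
  (forall n B', B <= B' -> (forall j, (j <= S n)%nat -> l2le (D j) (B' * alpha sig j)) ->
     l2le (D (S (S n))) (k / (INR n + 1) * B' * alpha sig (S (S n)))) ->
  l2le (D 1%nat) (B * (1 + k) ^ N * alpha sig 1) /\
  forall n, l2le (D (S (S n))) (k / (INR n + 1) * (B * (1 + k) ^ N) * alpha sig (S (S n))).
Proof.
  intros hs hk hN hB h0 h1 hstep.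
  assert (mono : forall a b : nat, (a <= b)%nat -> B * (1 + k) ^ a <= B * (1 + k) ^ b).
  { intros a b hab. apply Rmult_le_compat_l; [exact hB|]. apply Rle_pow; [lra|exact hab]. }
  assert (H : forall n j, (j <= S n)%nat -> l2le (D j) (B * (1 + k) ^ (Nat.min n N) * alpha sig j)).
  { induction n as [|n IH]; intros j hj.
    - simpl Nat.min. rewrite pow_O, Rmult_1_r.
      destruct j as [|[|j]]; [exact h0|exact h1|lia].
    - assert (hmono := mono (Nat.min n N) (Nat.min (S n) N) ltac:(lia)).
      pose proof (alpha_pos sig j hs) as ha.
      destruct (Nat.eq_dec j (S (S n))) as [->|hne].
      + eapply l2le_mono; [apply hstep; [|exact IH]|].
        * rewrite <- (Rmult_1_r B) at 1. rewrite <- (pow_O (1 + k)). apply mono. lia.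
        * apply Rmult_le_compat_r; [lra|].
          pose proof (pos_INR n) as hn.
          assert (hB0 : 0 <= B * (1 + k) ^ Nat.min n N)
            by (apply Rmult_le_pos; [exact hB|apply pow_le; lra]).
          destruct (Nat.le_gt_cases N n) as [hle|hlt].
          -- eapply Rle_trans; [|exact hmono]. rewrite <- (Rmult_1_l (B * (1 + k) ^ Nat.min n N)) at 2.
             apply Rmult_le_compat_r; [exact hB0|].
             apply le_INR in hle. apply Rle_div_l; lra.
          -- rewrite (Nat.min_l (S n) N), (Nat.min_l n N) in * by lia.
             replace (B * (1 + k) ^ S n) with ((1 + k) * (B * (1 + k) ^ n)) by (simpl; ring).
             apply Rmult_le_compat_r; [exact hB0|]. apply Rle_div_l; nra.
      + eapply l2le_mono; [apply IH; lia|]. apply Rmult_le_compat_r; lra. }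
  assert (H' : forall j, l2le (D j) (B * (1 + k) ^ N * alpha sig j)).
  { intros j. eapply l2le_mono; [apply (H j j); lia|].
    apply Rmult_le_compat_r; [pose proof (alpha_pos sig j hs); lra|apply mono; lia]. }
  (* The uniform bound has given up the factor [k/(n+1)]; one more use of [hstep] recovers it. *)
  split; [apply H'|]. intros n. apply hstep; [|intros; apply H'].
  rewrite <- (Rmult_1_r B) at 1. rewrite <- (pow_O (1 + k)). apply mono. lia.
Qed.

(** * Convergence of the weighted series *)

Lemma sums_to_exists a G : 0 <= G -> (forall n, 0 <= a n <= G * (6 / ((INR n + 1) * (INR n + 2)))) ->
  exists l, sums_to a l /\ 0 <= l <= 6 * G.
Proof.
  intros hG ha.
  assert (hb : forall n, 0 <= sum_f_R0 a n <= 6 * G).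
  { intros n. split; [apply cond_pos_sum; intros; apply ha|].
    (* The majorant telescopes, and this is its exact partial sum. *)
    apply Rle_trans with (6 * G * (1 - / (INR n + 2))).
    - induction n as [|n IH].
      + simpl sum_f_R0. destruct (ha O) as [_ h]. simpl INR in *. lra.
      + rewrite tech5. destruct (ha (S n)) as [_ h]. rewrite S_INR in *.
        pose proof (pos_INR n).
        replace (6 * G * (1 - / (INR n + 1 + 2))) with
          (6 * G * (1 - / (INR n + 2)) + G * (6 / ((INR n + 1 + 1) * (INR n + 1 + 2))))
          by (field; lra). lra.
    - pose proof (pos_INR n). assert (0 < / (INR n + 2)) by (apply Rinv_0_lt_compat; lra). nra. }
  destruct (growing_cv (fun N => sum_f_R0 a N)) as [l hl].
  - intros n. rewrite tech5. destruct (ha (S n)). lra.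
  - exists (6 * G). intros x [n ->]. apply hb.
  - exists l. split; [exact hl|]. split.
    + apply (is_lim_seq_le (fun _ => 0) (fun N => sum_f_R0 a N) 0 l);
        [intros; apply hb|apply is_lim_seq_const|now apply is_lim_seq_Reals].
    + apply (is_lim_seq_le (fun N => sum_f_R0 a N) (fun _ => 6 * G) l (6 * G));
        [intros; apply hb|now apply is_lim_seq_Reals|apply is_lim_seq_const].
Qed.

Lemma wt_pos sig n : 0 < sig -> 0 < wt sig n.
Proof.
  intros hs. unfold wt. apply Rdiv_lt_0_compat; [now apply pow_lt|].
  apply Rmult_lt_0_compat; apply pow_lt; apply INR_fact_lt_0.
Qed.

Lemma wt_nu sig n : 0 < sig -> wt sig n * nu sig n ^ 2 = 1.
Proof.
  intros hs. unfold wt, nu. pose proof (INR_fact_lt_0 n). pose proof (INR_fact_lt_0 (S n)).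
  assert (0 < sig ^ n) by now apply pow_lt.
  replace (sig ^ (2 * n)) with ((sig ^ n) ^ 2) by (rewrite <- pow_mult; f_equal; lia).
  rewrite pow_inv. field. repeat split; lra.
Qed.

Lemma normterm_bounds sig k D n A : 0 < sig -> l2le (D n) A ->
  0 <= normterm sig k D n <= wt sig n * INR n ^ k * (/ sig) ^ k * A ^ 2.
Proof.
  intros hs [hc [hA h]]. unfold normterm.
  assert (hsi : 0 < / sig) by now apply Rinv_0_lt_compat.
  assert (hcx : cont1 (fun x => (x / sig) ^ k)).
  { apply cont1_pow. unfold Rdiv. apply cont1_mult; [apply cont1_id|apply cont1_const]. }
  assert (hcn := cont1_Cnorm2 _ hc).
  rewrite J_Rint by (now apply cont1_mult).
  assert (hw : 0 <= wt sig n * INR n ^ k).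
  { apply Rmult_le_pos; [left; now apply wt_pos|apply pow_le, pos_INR]. }
  split.
  - apply Rmult_le_pos; [exact hw|]. apply J_ge0; [now apply cont1_mult|].
    intros x hx. apply Rmult_le_pos; [apply pow_le; unfold Rdiv; nra|apply Cnorm2_ge0].
  - rewrite (Rmult_assoc (wt sig n * INR n ^ k)). apply Rmult_le_compat_l; [exact hw|].
    apply Rle_trans with (J (fun x => (/ sig) ^ k * Cnorm2 (D n x))).
    + apply J_le; [now apply cont1_mult|apply cont1_mult; [apply cont1_const|exact hcn]|].
      intros x hx. apply Rmult_le_compat_r; [apply Cnorm2_ge0|].
      apply pow_incr. unfold Rdiv. nra.
    + rewrite J_scal by exact hcn. apply Rmult_le_compat_l; [apply pow_le; lra|exact h].
Qed.

Lemma wt_alpha sig n : 0 < sig ->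
  wt sig (S n) * alpha sig (S (S n)) ^ 2 = (INR n + 2) ^ 2 / (INR n + 3) ^ 4 * (/ sig) ^ 2.
Proof.
  intros hs. pose proof (wt_nu sig (S n) hs) as h. pose proof (nu_pos sig (S n) hs).
  assert (E : alpha sig (S (S n)) = nu sig (S n) * ((INR n + 2) / (INR n + 3) ^ 2 * / sig)).
  { unfold alpha, nu. rewrite (fact_S (S n)), !S_INR. pose proof (pos_INR n).
    replace ((/ sig) ^ S (S n)) with ((/ sig) ^ S n * / sig) by (simpl; ring).
    generalize ((/ sig) ^ S n). intros. field. lra. }
  rewrite E. rewrite Rpow_mult_distr, <- Rmult_assoc, h. pose proof (pos_INR n). field. lra.
Qed.

(** Here [D] is the chain of [u']: entry [n] is [u^(n+1)], and only entry 0 lacks the decaying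
    factor. For later entries the norm contributes [n^k], the weights [n^-2] (see [wt_alpha]) and
    the squared factor another [n^-2], which is summable up to [k = 2]. *)
Lemma normterm_decay sig k D n c A : (k <= 2)%nat -> 0 < sig -> 0 <= c ->
  l2le (D n) (match n with O => A * alpha sig 1 | S m => c / (INR m + 1) * A * alpha sig (S n) end) ->
  0 <= normterm sig k D n <=
    (1 + / sig) ^ 4 * (1 + c) ^ 2 * A ^ 2 * (6 / ((INR n + 1) * (INR n + 2))).
Proof.
  intros hk hs hc h.
  assert (hsi : 0 < / sig) by now apply Rinv_0_lt_compat.
  destruct (normterm_bounds sig k D n _ hs h) as [hl hu]. split; [exact hl|].
  eapply Rle_trans; [exact hu|]. clear hl hu h.
  (* One constant for all [k <= 2], whether [sig] is below or above 1. *)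
  assert (hp : (/ sig) ^ k * (/ sig) ^ 2 <= (1 + / sig) ^ 4).
  { rewrite <- pow_add. apply Rle_trans with ((1 + / sig) ^ (k + 2)).
    - apply pow_incr; lra.
    - apply Rle_pow; [lra|lia]. }
  assert (hA := pow2_ge_0 A). assert (hp4 : 0 < (1 + / sig) ^ 4) by (apply pow_lt; lra).
  assert (hp0 : 0 <= (/ sig) ^ k * (/ sig) ^ 2)
    by (apply Rmult_le_pos; apply pow_le; lra).
  destruct n as [|n].
  - assert (hk1 : INR 0 ^ k <= 1) by (destruct k as [|k]; simpl; lra).
    assert (hk0 : 0 <= INR 0 ^ k) by (apply pow_le; simpl; lra).
    replace (wt sig 0 * INR 0 ^ k * (/ sig) ^ k * (A * alpha sig 1) ^ 2) with
      (INR 0 ^ k * ((/ sig) ^ k * (/ sig) ^ 2) * A ^ 2 * / 16)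
      by (generalize (INR 0 ^ k) ((/ sig) ^ k); intros; unfold wt, alpha; simpl; field; lra).
    replace ((1 + / sig) ^ 4 * (1 + c) ^ 2 * A ^ 2 * (6 / ((INR 0 + 1) * (INR 0 + 2))))
      with (((1 + c) ^ 2 * 3) * ((1 + / sig) ^ 4 * A ^ 2)) by (simpl; field; lra).
    assert (X : INR 0 ^ k * ((/ sig) ^ k * (/ sig) ^ 2) * A ^ 2 <= (1 + / sig) ^ 4 * A ^ 2).
    { apply Rmult_le_compat_r; [exact hA|]. nra. }
    assert (0 <= (1 + / sig) ^ 4 * A ^ 2) by (apply Rmult_le_pos; lra). nra.
  - replace (wt sig (S n) * INR (S n) ^ k * (/ sig) ^ k *
      (c / (INR n + 1) * A * alpha sig (S (S n))) ^ 2) with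
      ((wt sig (S n) * alpha sig (S (S n)) ^ 2) * INR (S n) ^ k * (/ sig) ^ k *
       (c / (INR n + 1)) ^ 2 * A ^ 2) by ring.
    rewrite wt_alpha by exact hs. rewrite S_INR. pose proof (pos_INR n) as hn.
    set (t := INR n) in *.
    assert (hk1 : (t + 1) ^ k <= (t + 1) ^ 2) by (apply Rle_pow; [lra|exact hk]).
    assert (hk0 : 0 <= (t + 1) ^ k) by (apply pow_le; lra).
    replace ((t + 2) ^ 2 / (t + 3) ^ 4 * (/ sig) ^ 2 * (t + 1) ^ k * (/ sig) ^ k *
      (c / (t + 1)) ^ 2 * A ^ 2) with
      (((/ sig) ^ k * (/ sig) ^ 2) * c ^ 2 * A ^ 2
        * ((t + 1) ^ k * ((t + 2) ^ 2 / ((t + 3) ^ 4 * (t + 1) ^ 2)))) by (field; lra).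
    assert (hq : (t + 1) ^ k * ((t + 2) ^ 2 / ((t + 3) ^ 4 * (t + 1) ^ 2))
                 <= 6 / ((t + 1 + 1) * (t + 1 + 2))).
    { apply Rle_trans with ((t + 1) ^ 2 * ((t + 2) ^ 2 / ((t + 3) ^ 4 * (t + 1) ^ 2))).
      - apply Rmult_le_compat_r; [|exact hk1].
        apply Rdiv_le_0_compat; [apply pow2_ge_0|]. apply Rmult_lt_0_compat; apply pow_lt; lra.
      - replace ((t + 1) ^ 2 * ((t + 2) ^ 2 / ((t + 3) ^ 4 * (t + 1) ^ 2)))
          with ((t + 2) ^ 2 / (t + 3) ^ 4) by (field; lra).
        apply Rle_div_l; [apply pow_lt; lra|].
        replace (6 / ((t + 1 + 1) * (t + 1 + 2)) * (t + 3) ^ 4) with (6 * (t + 3) ^ 3 / (t + 2))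
          by (field; lra).
        apply (Rle_div_r ((t + 2) ^ 2)); [lra|]. replace ((t + 2) ^ 2 * (t + 2)) with ((t + 2) ^ 3) by ring.
        apply Rle_trans with ((t + 3) ^ 3); [apply pow_incr; lra|].
        assert (0 < (t + 3) ^ 3) by (apply pow_lt; lra). lra. }
    apply Rmult_le_compat.
    + apply Rmult_le_pos; [apply Rmult_le_pos; [exact hp0|apply pow2_ge_0]|exact hA].
    + apply Rmult_le_pos; [exact hk0|]. apply Rdiv_le_0_compat; [apply pow2_ge_0|].
      apply Rmult_lt_0_compat; apply pow_lt; lra.
    + apply Rmult_le_compat_r; [exact hA|]. apply Rmult_le_compat; try assumption.
      * apply pow2_ge_0.
      * apply pow_incr; lra.
    + exact hq.
Qed.

(** * Bounds read off from the hypotheses on W and f *)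

Lemma Gevrey2_bound sigs sig W : 0 < sig -> sig < sigs -> Gevrey sigs 2 W ->
  exists DW K, deriv_chain W DW /\ 0 <= K /\
    forall n x, 0 < x < 1 -> Cabs (DW n x) <= K * ((/ sig) ^ n * INR (fact n) ^ 2).
Proof.
  intros hs hss [DW [hDW [K [hK hb]]]]. exists DW, K. split; [exact hDW|split; [lra|]].
  intros n x hx. eapply Rle_trans; [now apply hb|].
  replace 2 with (INR 2) by reflexivity. rewrite Rpower_pow by apply INR_fact_lt_0.
  rewrite Rmult_assoc. apply Rmult_le_compat_l; [lra|].
  apply Rmult_le_compat_r; [apply pow2_ge_0|]. rewrite <- pow_inv. apply pow_incr.
  split; [left; apply Rinv_0_lt_compat; lra|]. apply Rinv_le_contravar; lra.
Qed.

Lemma deriv_chain_contI g D n : deriv_chain g D -> contI (D n).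
Proof. intros [_ h]. apply has_deriv01_contI with (D (S n)). intros x hx. now apply h. Qed.

Lemma deriv_chain_contI0 g D : deriv_chain g D -> contI g.
Proof.
  intros h. apply (contI_ext (D O)); [intros x hx; now apply (proj1 h)|].
  now apply deriv_chain_contI with g.
Qed.

Lemma deriv_chain_zero_left g D delta : deriv_chain g D ->
  (forall x, I01 x -> x < delta -> g x = C0) ->
  forall n x, I01 x -> x < delta -> D n x = C0.
Proof.
  intros [h0 hd] hg. induction n as [|n IH]; intros x hx hxd.
  - rewrite h0 by exact hx. now apply hg.
  - exact (has_deriv01_zero_left (D n) (D (S n)) delta (hd n) IH x hx hxd).
Qed.

(** A term of a convergent series of nonnegative terms is at most the sum, and [wt_nu] converts the
    n-th term of the [k = 0] series into an L^2 bound. The other two series have nonnegative sums,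
    so [v] dominates the first. *)
Lemma inY_l2le sig f v : 0 < sig -> inY sig f v ->
  exists F, deriv_chain f F /\ 0 <= v /\ forall n, l2le (F n) (sqrt v * nu sig n).
Proof.
  intros hs [F [hF [l0 [l1 [lb [h0 [h1 [hb ->]]]]]]]].
  assert (hc : forall n, contI (F n)) by (intros n; now apply deriv_chain_contI with f).
  assert (hself : forall n, l2le (F n) (sqrt (J (fun x => Cnorm2 (F n x))))).
  { intros n. split; [apply hc|split; [apply sqrt_pos|]]. rewrite pow2_sqrt; [lra|].
    apply J_ge0; [now apply cont1_Cnorm2|intros; apply Cnorm2_ge0]. }
  assert (hpos : forall k n, 0 <= normterm sig k F n)
    by (intros k n; eapply normterm_bounds; eauto).
  assert (hbpos : forall n, 0 <= bdterm sig F n).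
  { intros n. apply Rmult_le_pos; [|apply Cnorm2_ge0].
    pose proof (wt_pos sig n hs). nra. }
  assert (limpos : forall a l, (forall n, 0 <= a n) -> sums_to a l ->
    0 <= l /\ forall n, a n <= l).
  { intros a l ha hl.
    assert (hn : forall n, a n <= l).
    { intros n. apply Rle_trans with (sum_f_R0 a n); [|now apply sum_incr].
      destruct n as [|n]; [simpl; lra|]. rewrite tech5.
      pose proof (cond_pos_sum a n ha). lra. }
    split; [eapply Rle_trans; [apply (ha O)|apply hn]|exact hn]. }
  destruct (limpos _ _ (hpos O) h0) as [p0 q0].
  destruct (limpos _ _ (hpos 1%nat) h1) as [p1 _].
  destruct (limpos _ _ hbpos hb) as [pb _].
  exists F. split; [exact hF|split; [lra|]]. intros n.
  pose proof (nu_pos sig n hs) as hnu.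
  split; [apply hc|split; [apply Rmult_le_pos; [apply sqrt_pos|lra]|]].
  rewrite Rpow_mult_distr, pow2_sqrt by lra.
  specialize (q0 n). unfold normterm in q0.
  assert (cn := cont1_Cnorm2 _ (hc n)).
  rewrite J_Rint in q0 by (apply cont1_mult; [apply (cont1_const 1)|exact cn]).
  rewrite (J_ext _ (fun x => Cnorm2 (F n x))) in q0 by (intros; simpl; ring).
  simpl in q0. rewrite Rmult_1_r in q0.
  pose proof (wt_nu sig n hs) as E. simpl in E |- *.
  set (X := J _) in *. set (w := nu sig n) in *.
  replace X with (wt sig n * X * (w * (w * 1))) by (transitivity (wt sig n * (w * (w * 1)) * X); [ring|rewrite E; ring]).
  apply Rmult_le_compat_r; [nra|lra].
Qed.

Theorem mainTheorem15 :
  forall (W : R -> Cx) (sigs sig delta : R) (s : Cx),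
    Gevrey sigs 2 W -> 0 < sig -> sig < sigs -> 0 < delta ->
    exists C : R,
      forall (u up f : R -> Cx) (vY : R),
        H2 u up ->
        (forall x, 0 <= x < delta -> u x = C0) ->
        u 1 = C0 ->
        inY sig f vY ->
        weak_Ls s W u up f ->
        exists vX, inX sig u vX /\
          sqrt vX <= C * (sqrt vY + L2norm01 u).
Proof.
  intros W sigs sig delta s hG hs hss hd.
  destruct (Gevrey2_bound sigs sig W hs hss hG) as [DW [K [hDW [hK hWb]]]].
  set (k := kappa delta sig K s).
  assert (hsi : 0 < / sig) by now apply Rinv_0_lt_compat.
  assert (hd2 : 0 < delta ^ 2) by now apply pow_lt.
  assert (hk0 : 0 <= kappa0 sig K s).
  { unfold kappa0. pose proof (Rabs_pos (Re s)). pose proof (Rabs_pos (Im s)).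
    assert (0 <= (2 + (Rabs (Re s) + Rabs (Im s))) / sig) by (apply Rdiv_le_0_compat; lra). lra. }
  assert (hk : 0 <= k).
  { unfold k, kappa. apply Rdiv_le_0_compat; [|exact hd2].
    apply Rmult_le_pos; [lra|apply pow2_ge_0]. }
  destruct (INR_unbounded k) as [N hN].
  (* The energy estimate solved for the square of [||u'||], with [||f||] and [||u||] both bounded by
     [V]; the two coefficients 1/2 add up to 1. *)
  set (c1 := 2 / delta ^ 2 * (1 + K + Cnorm2 s / (2 * delta ^ 2))).
  assert (hc1 : 0 <= c1).
  { unfold c1. pose proof (Cnorm2_ge0 s).
    assert (0 <= Cnorm2 s / (2 * delta ^ 2)) by (apply Rdiv_le_0_compat; lra).
    apply Rmult_le_pos; [apply Rdiv_le_0_compat; lra|lra]. }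
  (* [c0 V] has to dominate [u], [u'] and [f] on their scales; [alpha 0 = 1] and
     [alpha 1 = 1/(4 sig)] account for the two summands. *)
  set (c0 := 1 + 4 * sig * sqrt c1).
  assert (hc0 : 1 <= c0).
  { unfold c0. pose proof (sqrt_pos c1). nra. }
  set (g0 := (1 + / sig) ^ 4 * (1 + k) ^ 2 * (c0 * (1 + k) ^ N) ^ 2).
  assert (hg0 : 0 <= g0).
  { unfold g0. apply Rmult_le_pos; [apply Rmult_le_pos|]; try apply pow2_ge_0. apply pow_le. lra. }
  (* Three series contribute at most [6 g0 V^2] each, and the boundary series is 0. *)
  exists (sqrt (18 * g0)).
  intros u up f vY [hu hup1] hu0 hu1 hY hw.
  assert (hz0 : forall x, I01 x -> x < delta -> u x = C0)
    by (intros x hx hxd; apply hu0; unfold I01 in hx; lra).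
  assert (hz1 := has_deriv01_zero_left u up delta hu hz0).
  assert (hcu : contI u) by now apply has_deriv01_contI with up.
  assert (hcup : contI up) by now apply H1_contI.
  destruct (inY_l2le sig f vY hs hY) as [F [hF [hvY hFb]]].
  assert (hst := weak_Ls_strong s W u up f (deriv_chain_contI0 _ _ hDW) hcu hcup
                   (deriv_chain_contI0 _ _ hF) hw).
  (* Left of [delta] every other term of the classical equation is 0, so [f] must vanish there;
     [uchain_eq] rests on this. *)
  assert (hf0 : forall x, I01 x -> x < delta -> f x = C0).
  { intros x hx hxd.
    assert (hsq0 : forall y, I01 y -> y < delta -> Cscal (y ^ 2) (up y) = C0)
      by (intros y hy hyd; rewrite hz1 by assumption; apply Cx_eq; simpl; ring).
    assert (E := has_deriv01_zero_left _ _ delta hst hsq0 x hx hxd). cbv beta in E.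
    rewrite hz0, hz1 in E by assumption.
    apply Cx_eq; [apply (f_equal Re) in E|apply (f_equal Im) in E]; simpl in E |- *; lra. }
  assert (hF0 := deriv_chain_zero_left f F delta hF hf0).
  assert (hst' : forall x, I01 x -> has_deriv01 (fun y => Cscal (y ^ 2) (up y))
    (Csub (Cadd (F O x) (Cmul (DW O x) (u x))) (Cmul s (up x))) x).
  { intros x hx. rewrite (proj1 hF), (proj1 hDW) by exact hx. now apply hst. }
  set (D := uchain delta s F DW u up).
  assert (hD : forall n x, I01 x -> has_deriv01 (D n) (D (S n) x) x).
  { apply uchain_deriv; auto.
    - intros n x hx. now apply hF.
    - intros n x hx. now apply hDW.
    - now apply up_deriv. }
  assert (hDz : forall n x, I01 x -> x < delta -> D n x = C0) by now apply uchain_zero.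
  assert (hDc : forall n, contI (D n)) by (intros n; apply has_deriv01_contI with (D (S n)); auto).
  assert (heq := uchain_eq delta s F DW u up hd hz0 hz1 hF0). fold D in heq.
  set (V := sqrt vY + L2norm01 u).
  assert (hL : L2norm01 u = sqrt (J (fun x => Cnorm2 (u x))))
    by (unfold L2norm01; rewrite J_Rint; [reflexivity|now apply cont1_Cnorm2]).
  assert (hJu : 0 <= J (fun x => Cnorm2 (u x)))
    by (apply J_ge0; [now apply cont1_Cnorm2|intros; apply Cnorm2_ge0]).
  pose proof (sqrt_pos vY) as hsv. pose proof (sqrt_pos (J (fun x => Cnorm2 (u x)))) as hsu.
  assert (hV : 0 <= V) by (unfold V; lra).
  assert (hVu : l2le u V).
  { split; [exact hcu|split; [exact hV|]]. rewrite <- (pow2_sqrt _ hJu). apply pow_incr.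
    unfold V. lra. }
  assert (hVF : forall n, l2le (F n) (V * nu sig n)).
  { intros n. eapply l2le_mono; [apply hFb|]. apply Rmult_le_compat_r; [left; now apply nu_pos|].
    unfold V. lra. }
  assert (hVup : l2le up (sqrt c1 * V)).
  { split; [exact hcup|split; [apply Rmult_le_pos; [apply sqrt_pos|exact hV]|]].
    rewrite Rpow_mult_distr, pow2_sqrt by exact hc1.
    assert (En := energy_estimate delta s K (DW O) u up (F O) hd hK
      (deriv_chain_contI _ _ O hDW)
      ltac:(intros x hx; eapply Rle_trans; [now apply hWb|]; simpl; lra)
      (deriv_chain_contI _ _ O hF) hcup hz1 (hu0 0 ltac:(lra)) hu1 hu hst').
    destruct (hVF O) as [_ [_ h1]]. destruct hVu as [_ [_ h2]].
    replace (nu sig 0) with 1 in h1 by (unfold nu; simpl; ring). rewrite Rmult_1_r in h1.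
    assert (hc : 0 <= Cnorm2 s / (2 * delta ^ 2))
      by (apply Rdiv_le_0_compat; [apply Cnorm2_ge0|lra]).
    apply Rmult_le_compat_l with (r := 1 / 2 + K + Cnorm2 s / (2 * delta ^ 2)) in h2; [|lra].
    unfold c1. set (r := Cnorm2 s / (2 * delta ^ 2)) in *.
    apply Rmult_le_reg_l with (delta ^ 2 / 2); [lra|].
    replace (delta ^ 2 / 2 * (2 / delta ^ 2 * (1 + K + r) * V ^ 2)) with ((1 + K + r) * V ^ 2)
      by (field; lra).
    lra. }
  assert (hB : 0 <= c0 * V) by nra.
  destruct (l2le_chain_bound sig k N (c0 * V) D hs hk ltac:(lra) hB) as [b1 b2].
  { eapply l2le_mono; [exact hVu|]. unfold alpha; simpl. nra. }
  { eapply l2le_mono; [exact hVup|].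
    replace (alpha sig 1) with (/ (4 * sig)) by (unfold alpha; simpl; field; lra).
    apply (Rle_div_r (sqrt c1 * V)); [lra|]. unfold c0. nra. }
  (* One round of the recursion: bound [rhs n], divide by [x^2], trade [nu n] for [alpha (n+2)]. *)
  { intros n B' hB' hj.
    assert (h := rhs_l2le sig K B' s F DW D n hs hK ltac:(lra)
      (fun i => deriv_chain_contI _ _ i hDW) hWb hj
      ltac:(eapply l2le_mono; [apply hVF|]; apply Rmult_le_compat_r; [left; now apply nu_pos|nra])).
    apply (l2le_ext _ (fun x => Cscal (x ^ 2) (D (S (S n)) x))) in h;
      [|intros x hx; symmetry; now apply heq].
    apply (l2le_weighted delta) in h; [|exact hd|apply hDc|apply hDz].
    eapply l2le_mono; [exact h|].
    pose proof (nu_alpha sig n hs) as hna.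
    apply Rmult_le_compat_l with (r := kappa0 sig K s * B' / delta ^ 2) in hna;
      [|apply Rdiv_le_0_compat; [apply Rmult_le_pos; lra|exact hd2]].
    pose proof (pos_INR n).
    replace (kappa0 sig K s * B' * nu sig n / delta ^ 2)
      with (kappa0 sig K s * B' / delta ^ 2 * nu sig n) by (field; lra).
    eapply Rle_trans; [exact hna|]. right. unfold k, kappa. field. lra. }
  set (A := c0 * V * (1 + k) ^ N) in *.
  set (D' := fun n => D (S n)).
  assert (hterm : forall j n, (j <= 2)%nat -> 0 <= normterm sig j D' n
    <= g0 * V ^ 2 * (6 / ((INR n + 1) * (INR n + 2)))).
  { intros j n hj.
    replace (g0 * V ^ 2) with ((1 + / sig) ^ 4 * (1 + k) ^ 2 * A ^ 2) by (unfold g0, A; ring).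
    apply normterm_decay; auto. destruct n as [|n]; [exact b1|apply b2]. }
  assert (hGV : 0 <= g0 * V ^ 2) by (apply Rmult_le_pos; [exact hg0|apply pow2_ge_0]).
  destruct (sums_to_exists _ _ hGV (fun n => hterm O n ltac:(lia))) as [l0 [s0 i0]].
  destruct (sums_to_exists _ _ hGV (fun n => hterm 1%nat n ltac:(lia))) as [l1 [s1 i1]].
  destruct (sums_to_exists _ _ hGV (fun n => hterm 2%nat n ltac:(lia))) as [l2 [s2 i2]].
  exists (l0 + l1 + l2 + 0). split.
  - exists D. split; [split; [reflexivity|exact hD]|split; [exact hu1|]].
    (* The boundary series is identically 0, because 0 lies left of [delta], where all derivatives
       vanish. *)
    exists l0, l1, l2, 0. repeat split; auto.
    intros eps he. exists O. intros n _. unfold Rdist.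
    rewrite (sum_eq _ (fun _ => 0)).
    + rewrite sum_cte, Rmult_0_l, Rminus_0_r, Rabs_R0. exact he.
    + intros m _. unfold bdterm. rewrite hDz; [|unfold I01; lra|exact hd].
      unfold Cnorm2; simpl. ring.
  - rewrite <- (sqrt_pow2 V hV), <- sqrt_mult; [|lra|apply pow2_ge_0].
    apply sqrt_le_1_alt. lra.
Qed.
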